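(* Let $\mathbf{k}$ be a field of characteristic zero and let $B\in\mathcal M(\mathbf{k})$. If $B$ satisfies Serre's condition $(S_2)$, then $B$ is normal. In particular, complete intersection surfaces in the class $\mathcal M(\mathbf{k})$ are normal, i.e. if $B\in\mathcal M(\mathbf{k})$ is a complete intersection over $\mathbf{k}$, then $B$ is normal.
   Context: For a $\mathbf{k}$-domain $B$ (an integral domain containing $\mathbf{k}$), a derivation $D:B\to B$ is locally nilpotent if for each $b\in B$ there is a natural number $n$ (depending on $b$) with $D^n(b)=0$; $\mathrm{LND}(B)$ denotes the set of locally nilpotent derivations of $B$ (including $0$). The Makar-Limanov invariant of $B$ is $\mathrm{ML}(B)=\bigcap_{D\in\mathrm{LND}(B)}\ker D$. $\mathcal M(\mathbf{k})$ is the class of $2$-dimensional affine (i.e. finitely generated) $\mathbf{k}$-domains $B$ with $\mathrm{ML}(B)=\mathbf{k}$; a surface $\operatorname{Spec} B$ is said to belong to $\mathcal M(\mathbf{k})$ if $B\in\mathcal M(\mathbf{k})$. Serre's condition $(S_2)$ for a noetherian ring $A$: $\operatorname{depth}A_{\mathfrak p}\ge\min(\operatorname{ht}\mathfrak p,2)$ for all $\mathfrak p\in\operatorname{Spec}A$. A domain $A$ containing $\mathbf{k}$ is a complete intersection over $\mathbf{k}$ if it is isomorphic to a quotient $\mathbf{k}[X_1,\dots,X_n]/(f_1,\dots,f_p)$ for some $n,p\in\mathbb N$, where $(f_1,\dots,f_p)$ is a prime ideal of $\mathbf{k}[X_1,\dots,X_n]$ of height $p$; then $\operatorname{Spec}A$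 is also called a complete intersection over $\mathbf{k}$. The field $\mathbf{k}$ is not assumed algebraically closed. *)

(* Defs.v *)
From HB Require Import structures.
From mathcomp Require Import all_boot all_order all_algebra.
From mathcomp Require Import ring_quotient.
From mathcomp Require Import boolp.
From mathcomp Require Import mpoly.

Set Implicit Arguments.
Unset Strict Implicit.
Unset Printing Implicit Defensive.

Import GRing.Theory.

Local Open Scope ring_scope.
Local Open Scope quotient_scope.

Definition is_max (S : nat -> Prop) (n : nat) : Prop :=
  S n /\ forall m, S m -> (m <= n)%N.

Definition ideal_gen (R : comNzRingType) (s : seq R) (y : R) : Prop :=
  exists c : nat -> R, y = \sum_(i < size s) c i * s`_i.

(* Ideals are the boolean predicates of ring_quotient; boolp turns any
   Prop-valued ideal into one of these, so quantifying over [prime_idealr R]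
   is quantifying over all of Spec R. *)
Definition prime_lt (R : comNzRingType) (P Q : prime_idealr R) : Prop :=
  {subset P <= Q} /\ exists2 x : R, x \in Q & x \notin P.

(* P_0 < P_1 < ... < P_n; the values of P beyond n are irrelevant. *)
Definition prime_chain (R : comNzRingType) (n : nat) (P : nat -> prime_idealr R)
  : Prop := forall i, (i < n)%N -> prime_lt (P i) (P i.+1).

Definition is_height (R : comNzRingType) (P : prime_idealr R) (h : nat) : Prop :=
  is_max (fun n => exists2 C, prime_chain n C & C n =i P) h.

Definition is_krull_dim (R : comNzRingType) (d : nat) : Prop :=
  is_max (fun n => exists C : nat -> prime_idealr R, prime_chain n C) d.

Section Localization.
Variables (A : idomainType) (P : prime_idealr A).

Definition loc_pred : {pred {fraction A}} :=
  fun x => `[< exists a s : A, s \notin P /\ x = tofrac a / tofrac s >].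

Lemma notin_prime_neq0 (s : A) : s \notin P -> tofrac s != 0.
Proof. by apply: contraNneq => /eqP; rewrite tofrac_eq0 => /eqP->; apply: idealr0. Qed.

Lemma loc_subring_closed : subring_closed loc_pred.
Proof.
split.
- apply/asboolP; exists 1, 1; rewrite divr1 tofrac1; split=> //.
  by rewrite idealr1.
- move=> x y /asboolP[a [s [sP ->]]] /asboolP[b [t [tP ->]]].
  apply/asboolP; exists (a * t - b * s), (s * t).
  rewrite prime_idealrM (negbTE sP) (negbTE tP); split=> //.
  by rewrite -mulNr addf_div ?notin_prime_neq0 // mulNr rmorphB !rmorphM.
- move=> x y /asboolP[a [s [sP ->]]] /asboolP[b [t [tP ->]]].
  apply/asboolP; exists (a * b), (s * t).
  rewrite prime_idealrM (negbTE sP) (negbTE tP); split=> //.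
  by rewrite !rmorphM /= mulf_div.
Qed.

HB.instance Definition _ :=
  GRing.isSubringClosed.Build {fraction A} loc_pred loc_subring_closed.

(* The local ring A_P, realized inside the fraction field of the domain A. *)
Record localization := Localization {
  loc_val :> {fraction A};
  _ : loc_val \in loc_pred
}.

HB.instance Definition _ := [isSub for loc_val].
HB.instance Definition _ := [Choice of localization by <:].
HB.instance Definition _ :=
  [SubChoice_isSubComNzRing of localization by <:].
End Localization.

Section Depth.
Variable R : comNzRingType.

Definition regular_seq (s : seq R) : Prop :=
  (forall (i : nat) (y : R), (i < size s)%N ->
     ideal_gen (take i s) (s`_i * y) -> ideal_gen (take i s) y)
  /\ ~ ideal_gen s 1.

(* For R local, the maximal ideal is the set of non-units; depth is the supremum
   in N U {oo} of the lengths of the regular sequences contained in it. *)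
Definition local_depth_ge (n : nat) : Prop :=
  exists s : seq R,
    [/\ (n <= size s)%N, regular_seq s
      & forall x, x \in s -> ~ exists y, x * y = 1].
End Depth.

(* Only meaningful for A noetherian (so that every prime has a height). *)
Definition serre_S2 (A : idomainType) : Prop :=
  forall (P : prime_idealr A) (h : nat),
    is_height P h -> local_depth_ge (localization P) (minn h 2).

Definition normal_domain (A : idomainType) : Prop :=
  forall x : {fraction A},
    integralOver (@tofrac A) x -> exists a : A, x = tofrac a.

(* Derivations are not required to be k-linear. *)
Definition derivation (B : comNzRingType) (D : B -> B) : Prop :=
  {morph D : x y / x + y} /\ forall x y, D (x * y) = D x * y + x * D y.

Definition locally_nilpotent (B : comNzRingType) (D : B -> B) : Prop :=
  forall b, exists n, iter n D b = 0.

Definition LND (B : comNzRingType) (D : B -> B) : Prop :=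
  derivation D /\ locally_nilpotent D.

Definition ML (B : comNzRingType) (b : B) : Prop :=
  forall D : B -> B, LND D -> D b = 0.

(* A k-domain is an integral domain B with a ring morphism iota : k -> B, which
   is injective since k is a field. *)
Section KDomain.
Variables (k : fieldType) (B : idomainType) (iota : {rmorphism k -> B}).

Definition affine : Prop :=
  exists (n : nat) (x : 'I_n -> B),
    forall b : B, exists q : {mpoly k[n]}, b = mmap iota x q.

Definition classM : Prop :=
  [/\ affine, is_krull_dim B 2
    & forall b : B, ML b <-> exists c : k, b = iota c].

(* B is isomorphic, as a k-algebra, to the quotient by I = (f_1, ..., f_p). *)
Definition complete_intersection : Prop :=
  exists (n : nat) (f : seq {mpoly k[n]}) (I : prime_idealr {mpoly k[n]})
         (phi : {rmorphism {ideal_quot I} -> B}),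
    [/\ forall q, q \in I <-> ideal_gen f q,
        is_height I (size f),
        bijective phi
      & forall c : k, phi (\pi_{ideal_quot I} c%:MP) = iota c].
End KDomain.

(* Main.v *)
Require Import Defs.
From HB Require Import structures.
From mathcomp Require Import all_boot all_order all_algebra.
From mathcomp Require Import ring_quotient polyXY boolp wochoice mpoly ring zify.

(** Let [x] be a fraction of [B] that is integral over [B]. The ring [B] has two nonzero locally
    nilpotent derivations [D1] and [D2] whose kernels meet in [k] only ([two_LNDs]). For each of
    them, [B] becomes a polynomial ring in one variable after the nonzero elements of the kernel
    are inverted ([slice_expansion]). Such a ring is integrally closed, so that [x] has a
    denominator [a] in the kernel of [D1] and a denominator [c] in the kernel of [D2]
    ([LND_conductor]). If [a] or [c] is a constant, then [x] lies in [B]; otherwise it is enough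
    that [a, c] be a regular sequence of [B], since then [c (a x) = a (c x)] forces [a x] into
    [a B].

    The key fact is that [B] is integral over the polynomial ring [k[a, c]]. The field of
    fractions of the kernel of [D1] is algebraic over [k(a)], and [c] is a non-constant polynomial
    in a local slice of [D1], so that [B] is integral over [k(a)[c]]
    ([LND_integral_over_line]); by symmetry it is integral over [k(c)[a]]. By Gauss's lemma the
    minimal polynomial over [k(a, c)] of an element of [B] has its coefficients in both rings,
    hence in their intersection [k[a, c]] ([bivariate_minpoly]).

    Under condition (S2), going down for [k[a, c]] inside [B] ([going_down]) shows that a prime
    containing [a] and [c] has height 2, hence depth at least 2. Since [B / (a, c)] is algebraic
    over [k], powers of the members of a regular sequence at that prime are denominators of [x], and
    [x] lies in the local ring ([serre_S2_descent]).

    For a complete intersection [k[X_1, ..., X_n] / (f_1, ..., f_p)] the height of the ideal of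
    relations gives [p + 2 <= n]. The [p + 2] elements [f_1, ..., f_p, a, c] generate an ideal that
    contains a monic polynomial in each of the [n] variables, and these polynomials form a regular
    sequence. By the depth sensitivity of the Koszul complex ([koszul_acyclic]) all relations
    between the [p + 2] generators are consequences of the trivial ones, whence [c] is regular
    modulo [(f_1, ..., f_p, a)] ([complete_intersection_regular]).

    The bounds on numbers of algebraically independent elements come from two comparisons with
    chains of primes: a finitely generated domain has at least as large a Krull dimension as
    transcendence degree ([trdeg_le_krull]), and chains are no longer than the number of
    generators ([chain_le_gens]). *)

Set Implicit Arguments.
Unset Strict Implicit.
Unset Printing Implicit Defensive.

Import GRing.Theory.
Local Open Scope ring_scope.

(** * Fraction fields, prime ideals, iterated polynomial rings *)

Lemma fracP (R : idomainType) (x : {fraction R}) :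
  exists p q : R, q != 0 /\ x = tofrac p / tofrac q.
Proof.
have [r ->] : exists r : {ratio R}, x = \pi_({fraction R})%qT r.
  by exists (repr x); rewrite reprK.
exists r.1, r.2; split; first exact: denom_ratioP.
have tE (a : R) : tofrac a = \pi_({fraction R})%qT (Ratio a 1).
  by rewrite /tofrac; unlock.
rewrite !tE.
have -> : (\pi_({fraction R}) (Ratio (frac r).2 1))^-1%qT =
   \pi_({fraction R})%qT (Ratio 1 r.2).
  rewrite -[LHS]/(FracField.inv _) -FracField.pi_inv /FracField.invf.
  by rewrite numer_Ratio ?oner_eq0 // denom_Ratio ?oner_eq0.
rewrite -[RHS]/(FracField.mul _ _) -FracField.pi_mul /FracField.mulf.
rewrite !numden_Ratio ?oner_eq0 ?denom_ratioP //.
by rewrite mulr1 mul1r FracField.Ratio_numden.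
Qed.

Lemma frac_ext (R : idomainType) (K : fieldType) (f : {rmorphism R -> K}) :
  injective f -> exists g : {rmorphism {fraction R} -> K},
    forall a, g (tofrac a) = f a.
Proof.
move=> f_inj.
have f0 a : (f a == 0) = (a == 0) by rewrite -(rmorph0 f) (inj_eq f_inj).
have tf0 (a : R) : (tofrac a == 0) = (a == 0) by rewrite tofrac_eq0.
pose P x y := forall p q : R, q != 0 -> x = tofrac p / tofrac q -> y = f p / f q.
have exP x : exists y, P x y.
  have [p [q [q0 ->]]] := fracP x; exists (f p / f q) => p' q' q'0 /eqP.
  rewrite eqr_div ?tf0 // -!tofracM tofrac_eq => /eqP e.
  by apply/eqP; rewrite eqr_div ?f0 // -!rmorphM e.
pose g x := projT1 (cid (exP x)).
have gE p q : q != 0 -> g (tofrac p / tofrac q) = f p / f q.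
  by move=> q0; rewrite /g; case: cid => y /= /(_ p q q0 erefl).
have gT a : g (tofrac a) = f a.
  by rewrite -[tofrac a]divr1 -tofrac1 gE ?oner_eq0 // rmorph1 divr1.
have gB : zmod_morphism g.
  move=> x y; have [p [q [q0 ->]]] := fracP x; have [s [t [t0 ->]]] := fracP y.
  rewrite -mulNr addf_div ?tf0 // -tofracN -!tofracM -tofracD.
  rewrite !gE ?mulf_neq0 // -mulNr addf_div ?f0 //.
  by rewrite rmorphD !rmorphM rmorphN.
have gM : monoid_morphism g.
  split; first by rewrite -tofrac1 gT rmorph1.
  move=> x y; have [p [q [q0 ->]]] := fracP x; have [s [t [t0 ->]]] := fracP y.
  by rewrite mulf_div -!tofracM !gE ?mulf_neq0 // mulf_div !rmorphM.
pose gA := GRing.isZmodMorphism.Build _ _ g gB.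
pose gMM := GRing.isMonoidMorphism.Build _ _ g gM.
pose g' : {rmorphism {fraction R} -> K} := HB.pack g gA gMM.
by exists g'.
Qed.

Lemma prime_pack (R : comNzRingType) (P : R -> Prop) :
    P 0 -> ~ P 1 -> (forall a u v, P u -> P v -> P (a * u + v)) ->
    (forall u v, P (u * v) -> P u \/ P v) ->
  exists Q : prime_idealr R, forall x, x \in Q <-> P x.
Proof.
move=> P0 P1 PD PM; pose S : R -> bool := fun x => `[< P x >].
have S_ideal : idealr_closed S.
  split; [exact/asboolP | exact/asboolP |].
  by move=> a u v /asboolP Pu /asboolP Pv; apply/asboolP/PD.
have S_prime : prime_idealr_closed S.
  by move=> u v /asboolP/PM[] Pu; apply/orP; [left|right]; apply/asboolP.
pose mi := isIdealr.Build R S S_ideal.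
pose mp := isPrimeIdealrClosed.Build R S S_prime.
pose Q : prime_idealr R := HB.pack S mi mp.
by exists Q => x; split=> /asboolP.
Qed.

Lemma zero_prime (R : idomainType) : exists Z : prime_idealr R, forall x, x \in Z <-> x = 0.
Proof.
apply: prime_pack.
- by [].
- by move/eqP; rewrite oner_eq0.
- by move=> a u v -> ->; rewrite mulr0 addr0.
- by move=> u v /eqP; rewrite mulf_eq0 => /orP[]/eqP; [left|right].
Qed.

Lemma prime_preim (R S : comNzRingType) (G : {rmorphism R -> S}) (P : prime_idealr S) :
  exists Q : prime_idealr R, forall x, x \in Q <-> G x \in P.
Proof.
apply: prime_pack.
- by rewrite rmorph0 idealr0.
- by rewrite rmorph1 idealr1.
- by move=> a u v uP vP; rewrite rmorphD rmorphM rpredD // idealMr.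
- by move=> u v; rewrite rmorphM prime_idealrM => /orP.
Qed.

(** An ideal that is maximal among those containing [I] and disjoint from the multiplicative
    set [M] is prime: two larger ideals both meet [M], hence so does their product. *)
Lemma prime_avoid (R : comNzRingType) (I M : R -> Prop) :
    I 0 -> (forall a u v, I u -> I v -> I (a * u + v)) ->
    M 1 -> (forall u v, M u -> M v -> M (u * v)) ->
    (forall x, I x -> M x -> False) ->
  exists Q : prime_idealr R,
    (forall x, I x -> x \in Q) /\ (forall x, M x -> x \notin Q).
Proof.
move=> I0 ID M1 MM IM.
pose T := {classic (R -> Prop)}.
pose le : rel T := fun J J' =>
  `[< forall x, (J : R -> Prop) x -> (J' : R -> Prop) x >].
pose S : {pred T} := fun J : T => `[< let J := (J : R -> Prop) in
  [/\ forall x, I x -> J x, forall a u v, J u -> J v -> J (a * u + v) &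
      forall x, J x -> M x -> False] >].
have [||C sCS woC|J /asboolP /= [IJ JD JM] Jmax] := @Zorn's_lemma T le S.
- by move=> J _; apply/asboolP.
- by move=> J J' J'' _ _ _ /asboolP h /asboolP h'; apply/asboolP => x /h/h'.
- have chC := wo_chainW woC.
  have [[J0 J0C]|noC] := pselect (exists J : T, J \in C); last first.
    by exists I; [apply/asboolP | move=> J JC; case: noC; exists J].
  exists (fun x => exists2 J : T, J \in C & (J : R -> Prop) x); last first.
    by move=> J JC; apply/asboolP => x Jx; exists J.
  apply/asboolP; split.
  + by move=> x Ix; exists J0 => //; have /asboolP[/(_ x Ix)] := sCS _ J0C.
  + move=> a u v [J JC Ju] [J' J'C J'v].
    have [/asboolP h|/asboolP h] := orP (chC _ _ JC J'C).
      by exists J' => //; have /asboolP[_ D _] := sCS _ J'C; apply: D => //; apply: h.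
    by exists J => //; have /asboolP[_ D _] := sCS _ JC; apply: D => //; apply: h.
  + by move=> x [J JC Jx]; have /asboolP[_ _ /(_ x Jx)] := sCS _ JC.
have J0 : (J : R -> Prop) 0 by apply: IJ.
have JMl a u : (J : R -> Prop) u -> (J : R -> Prop) (a * u).
  by move=> Ju; rewrite -[a * u]addr0; apply: JD.
(* by maximality, J enlarged by an element outside J meets M *)
have hit u : ~ (J : R -> Prop) u ->
    exists m, M m /\ exists a j, (J : R -> Prop) j /\ m = a * u + j.
  move=> Ju; apply: contrapT => nohit; apply: Ju.
  pose J' : T := fun x => exists a j, (J : R -> Prop) j /\ x = a * u + j.
  have J'S : J' \in S.
    apply/asboolP; split.
    - by move=> x Ix; exists 0, x; rewrite mul0r add0r; split=> //; apply: IJ.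
    - move=> a _ _ [b [j [Jj ->]]] [b' [j' [Jj' ->]]].
      by exists (a * b + b'), (a * j + j'); split; [apply: JD | ring].
    - move=> x [a [j [Jj xE]]] Mx; apply: nohit.
      by exists x; split=> //; exists a, j.
  have /(Jmax J' J'S)/asboolP : le J J'; last apply.
    by apply/asboolP => x Jx; exists 0, x; rewrite mul0r add0r.
  by exists 1, 0; rewrite mul1r addr0.
have [//||//||Q QE] := @prime_pack R (J : R -> Prop).
- by move=> /JM; apply.
- move=> u v Juv; apply: contrapT => /not_orP[/hit[m [Mm [a [j [Jj mE]]]]]].
  case/hit => [m' [Mm' [a' [j' [Jj' mE']]]]].
  apply: JM (MM _ _ Mm Mm'); rewrite mE mE'.
  have -> : (a * u + j) * (a' * v + j') =
    (a * a') * (u * v) + ((a * u) * j' + ((a' * v) * j + j * j')) by ring.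
  by apply: (JD) => //; apply: (JD) => //; apply: (JD) => //; apply: JMl.
exists Q; split=> x; first by move=> /IJ/QE.
by move=> Mx; apply/negP => /QE /JM; apply.
Qed.

Section Eval.
Variables (R S : comNzRingType) (f : {rmorphism R -> S}) (y : S).
Definition evalX : {poly R} -> S := horner_eval y \o map_poly f.
HB.instance Definition _ := GRing.RMorphism.on evalX.
Lemma evalXE p : evalX p = (map_poly f p).[y]. Proof. by []. Qed.
Lemma evalXC c : evalX c%:P = f c.
Proof. by rewrite evalXE map_polyC hornerC. Qed.
Lemma evalX_X : evalX 'X = y.
Proof. by rewrite evalXE map_polyX hornerX. Qed.
End Eval.

(** Polynomials in [d] variables, one variable at a time: inductions on [d] evaluate or
    specialize the outermost variable. *)
Fixpoint MP (k : idomainType) (d : nat) : idomainType :=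
  if d is d'.+1 then ({poly (MP k d')} : idomainType) else k.

Fixpoint MPC (k : idomainType) d : {rmorphism k -> MP k d} :=
  match d return {rmorphism k -> MP k d} with
  | 0 => (idfun : {rmorphism k -> k})
  | d'.+1 => (polyC \o MPC k d' : {rmorphism k -> {poly MP k d'}})
  end.


(** * Krull dimension and transcendence degree *)

Definition char0 (R : nzRingType) := forall n, n.+1%:R != 0 :> R.

Lemma pchar0_char0 (k : fieldType) : [pchar k] =i pred0 -> char0 k.
Proof. by move=> /pcharf0P hk n; rewrite hk. Qed.

Lemma rmorph_char0 (k : fieldType) (R : nzRingType) (f : {rmorphism k -> R}) :
  char0 k -> char0 R.
Proof. by move=> hk n; rewrite -(rmorph_nat f) fmorph_eq0. Qed.

Lemma char0_natr_inj (R : nzRingType) : char0 R -> injective (fun n => n%:R : R).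
Proof.
move=> hR m n; wlog le : m n / (m <= n)%N.
  by move=> W e; have [/W->|/ltnW/W->] := leqP m n.
move=> e; apply/eqP; rewrite eqn_leq le /= leqNgt; apply/negP => lt.
have := hR (n - m).-1; rewrite prednK ?subn_gt0 // natrB // -e subrr eqxx //.
Qed.

Lemma exists_nonroot (R : idomainType) (p : {poly R}) :
  char0 R -> p != 0 -> exists n : nat, p.[n%:R] != 0.
Proof.
move=> hR p0; apply: contrapT => /forallNP h.
have := max_poly_roots (rs := [seq n%:R | n <- iota 0 (size p)]) p0.
rewrite size_map size_iota ltnn => W; suff: false by []; apply: W.
  by apply/allP => _ /mapP[n _ ->]; apply/negPn/negP/h.
by rewrite map_inj_uniq ?iota_uniq //; apply: char0_natr_inj.
Qed.

Lemma horner_map_sum (R S : nzRingType) (f : R -> S) (q : {poly R}) b :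
  (map_poly f q).[b] = \sum_(i < size q) f q`_i * b ^+ i.
Proof. by rewrite /map_poly horner_poly. Qed.

Lemma idealr_subXX (R : comNzRingType) (I : idealr R) x y n :
  x - y \in I -> x ^+ n - y ^+ n \in I.
Proof. by move=> h; rewrite subrXX mulrC idealMr. Qed.

(** Going up, one variable at a time: a prime lying over 0 is enlarged so that it contains the
    last variable minus a constant, the constant being chosen so that the denominator [s]
    does not vanish there. *)
Lemma prime_chain_above (k : fieldType) (B : comNzRingType) d :
    char0 k ->
  forall (Q : prime_idealr B) (ev : {rmorphism MP k d -> B}) (s : MP k d),
    s != 0 -> (forall p, ev p \in Q -> p = 0) ->
    (forall b, exists q : {poly MP k d}, exists N,
       lead_coef q = s ^+ N /\ (map_poly ev q).[b] \in Q) ->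
  exists C : nat -> prime_idealr B, prime_chain d C /\ C 0%N = Q.
Proof.
move=> hk; elim: d => [|d IH] Q ev s s0 ev_inj algB.
  by exists (fun=> Q); split.
change ({rmorphism {poly MP k d} -> B}) in (type of ev).
change {poly MP k d} in (type of s).
have hR : char0 (MP k d) by apply: rmorph_char0 (MPC k d) hk.
have [n sn] := exists_nonroot hR s0.
pose y := ev ('X - n%:R%:P).
have evy p : exists b, ev p - ev (p.[n%:R])%:P = b * y.
  have /factor_theorem[r rE] : root (p - p.[n%:R]%:P) n%:R.
    by rewrite /root !hornerE subrr.
  by exists (ev r); rewrite -rmorphB rE rmorphM.
have [||| |x [b [q0 [q0Q xE]]] [p [xE' pn]]|Q' [IQ' MQ']] := @prime_avoid B
  (fun x => exists b q, q \in Q /\ x = b * y + q)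
  (fun x => exists p, x = ev p /\ p.[n%:R] != 0).
- by exists 0, 0; rewrite idealr0 mul0r addr0.
- move=> a _ _ [b [q [qQ ->]]] [b' [q' [q'Q ->]]].
  exists (a * b + b'), (a * q + q'); split; last by ring.
  by rewrite rpredD // idealMr.
- by exists 1; rewrite rmorph1 hornerE oner_eq0.
- move=> _ _ [p [-> pn]] [q [-> qn]]; exists (p * q).
  by rewrite rmorphM hornerM mulf_neq0.
- have [q [N [qs qQ]]] := algB b.
  have q_neq0 : q != 0 by rewrite -lead_coef_eq0 qs expf_neq0.
  pose e := (size q).-1.
  have eE : size q = e.+1 by rewrite prednK // size_poly_gt0.
  (* the equation of b, homogenized by y: there b * y may be replaced by ev p modulo Q *)
  pose G : {poly MP k d} := \sum_(i < e.+1) q`_i * p ^+ i * ('X - n%:R%:P) ^+ (e - i).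
  have G0 : G = 0.
    apply: ev_inj; rewrite -[ev G](subrK (y ^+ e * (map_poly ev q).[b])).
    rewrite rpredD ?idealMr // horner_map_sum mulr_sumr eE rmorph_sum /= -sumrB.
    apply: rpred_sum => i _; rewrite !rmorphM /= !rmorphXn /= -/y.
    have -> : y ^+ e = y ^+ (e - i) * y ^+ i by rewrite -exprD subnK // -ltnS.
    have -> (u P z w c : B) : u * P * z - z * w * (u * c) = (u * z) * (P - c * w).
      by ring.
    rewrite -exprMn.
    apply: idealMr; apply: idealr_subXX.
    by rewrite -xE' xE addrC addKr.
  have /eqP : G.[n%:R] = 0 by rewrite G0 horner0.
  rewrite horner_sum (bigD1 (Ordinal (ltnSn e))) //= big1 => [|i].
    rewrite subnn expr0 mulr1 addr0 hornerM horner_exp -/(lead_coef q) -/e.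
    by rewrite mulf_eq0 qs horner_exp !expf_eq0 (negbTE sn) (negbTE pn) !andbF.
  rewrite -val_eqE /= => ne; rewrite !hornerE subrr expr0n subn_eq0 leqNgt.
  by rewrite ltn_neqAle ne -ltnS ltn_ord /= mulr0.
have QQ' x : x \in Q -> x \in Q'.
  by move=> xQ; apply: IQ'; exists 0, x; rewrite mul0r add0r.
have yQ' b : b * y \in Q' by apply: IQ'; exists b, 0; rewrite addr0 idealr0.
pose ev' : {rmorphism MP k d -> B} := ev \o polyC.
have [p pQ|b|C [Cc C0]] := IH Q' ev' s.[n%:R] sn.
- apply/eqP/negPn/negP => p0.
  suff /negP : ev' p \notin Q' by [].
  by apply: MQ'; exists p%:P; rewrite hornerC.
- have [q [N [qs qQ]]] := algB b.
  exists (map_poly (horner_eval n%:R) q), N.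
  split.
    have sE : horner_eval n%:R (lead_coef q) = s.[n%:R] ^+ N.
      by rewrite qs -horner_exp.
    rewrite lead_coef_map_eq; first exact: sE.
    by rewrite -[X in X != 0]/(horner_eval n%:R (lead_coef q)) sE expf_neq0.
  rewrite -map_poly_comp -[_.[b]](subrK (map_poly ev q).[b]) rpredD //; last exact: QQ'.
  rewrite !horner_map_sum -sumrB rpred_sum // => i _.
  rewrite -mulrBl mulrC idealMr // -opprB rpredN /=.
  by have [c ->] := evy q`_i; apply: yQ'.
exists (fun i => if i is i'.+1 then C i' else Q); split=> // -[|i] lti; last exact: Cc.
rewrite C0; split; first exact: QQ'.
exists y; first by rewrite -[y]mul1r.
apply/negP => /ev_inj/eqP; rewrite polyXsubC_eq0 //.
Qed.


Lemma mmap_closed (k B : comNzRingType) (iota : {rmorphism k -> B}) n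
    (x : 'I_n -> B) (P : B -> Prop) :
    (forall c, P (iota c)) -> (forall i, P (x i)) ->
    (forall u v, P u -> P v -> P (u + v)) -> (forall u v, P u -> P v -> P (u * v)) ->
  forall q : {mpoly k[n]}, P (mmap iota x q).
Proof.
move=> PC Px PD PM; elim/mpolyind => [|c m p _ _ IH].
  by rewrite rmorph0 -(rmorph0 iota).
rewrite rmorphD /= mmapZ mmapX; apply: (PD) => //; apply: (PM) => //.
rewrite /mmap1; elim/big_ind: _ => [|//|i _]; first by rewrite -(rmorph1 iota).
elim: (m i) => [|e IHe]; first by rewrite expr0 -(rmorph1 iota).
by rewrite exprS; apply: (PM).
Qed.

(** An algebraic equation becomes monic after multiplication by a power of its leading
    coefficient. *)
Lemma integral_lead_coef (R S : comNzRingType) (f : {rmorphism R -> S}) x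
    (q : {poly R}) :
  (1 < size q)%N -> evalX f x q = 0 -> integralOver f (f (lead_coef q) * x).
Proof.
move=> q1 qx0; set l := lead_coef q; pose n := (size q).-1.
have nE : size q = n.+1 by rewrite prednK // ltnW.
have n0 : (0 < n)%N by rewrite -ltnS -nE.
pose r := \poly_(i < n) (q`_i * l ^+ (n.-1 - i)).
have sr : (size r < size ('X^n : {poly R}))%N by rewrite size_polyXn ltnS size_poly.
exists ('X^n + r); first by rewrite monicE lead_coefDl // lead_coefXn.
rewrite /root -[_.[_]]/(evalX f (f l * x) ('X^n + r)) rmorphD rmorphXn /= evalX_X.
have -> : evalX f (f l * x) r =
    f l ^+ n.-1 * \sum_(i < n) f q`_i * x ^+ i.
  rewrite evalXE -[map_poly f r]/(map_poly f r) mulr_sumr.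
  have -> : map_poly f r = \poly_(i < n) (f (q`_i) * f l ^+ (n.-1 - i)).
    apply/polyP => i; rewrite coef_map !coef_poly /=.
    by case: ifP => _; rewrite ?rmorph0 // rmorphM rmorphXn.
  rewrite horner_poly; apply: eq_bigr => i _.
  have le : (i <= n.-1)%N by rewrite -ltnS prednK.
  by rewrite exprMn -[in RHS](subnK le) exprD; ring.
have : \sum_(i < n.+1) f q`_i * x ^+ i = 0 by rewrite -nE -horner_map_sum.
rewrite big_ord_recr /= -[q`_n]/l => /eqP; rewrite addrC addr_eq0 => /eqP e.
have lS : f l ^+ n = f l ^+ n.-1 * f l by rewrite -exprSr prednK.
by rewrite exprMn lS -mulrA e mulrN addNr.
Qed.

Definition algebraic (R : comNzRingType) (S : comNzRingType) (f : {rmorphism R -> S}) y :=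
  exists q : {poly R}, q != 0 /\ evalX f y q = 0.

Lemma evalX_inj (R S : comNzRingType) (f : {rmorphism R -> S}) y :
  ~ algebraic f y -> forall p, evalX f y p = 0 -> p = 0.
Proof. by move=> h p p0; apply/eqP/negPn/negP => pn; apply: h; exists p. Qed.

Section TrDeg.
Variables (k : fieldType) (B : idomainType) (iota : {rmorphism k -> B}).

(** The elements of [xs] that are not yet algebraic are adjoined as new variables. *)
Lemma transcendental_extension (xs : seq B) d (ev : {rmorphism MP k d -> B}) :
    (forall p, ev p = 0 -> p = 0) -> (forall c, ev (MPC k d c) = iota c) ->
  exists d' (ev' : {rmorphism MP k d' -> B}),
    [/\ (d <= d')%N, forall p, ev' p = 0 -> p = 0,
        forall c, ev' (MPC k d' c) = iota c,
        forall b, b \in xs -> algebraic ev' b &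
        forall b, algebraic ev b -> algebraic ev' b].
Proof.
elim: xs d ev => [|x xs IH] d ev ev_inj ev_iota; first by exists d, ev.
have [xalg|/evalX_inj x_inj] := pselect (algebraic ev x).
  have [d' [ev' [dd' inj' i' alg' ext']]] := IH d ev ev_inj ev_iota.
  exists d', ev'; split=> // b; rewrite inE => /predU1P[->|]; [exact: ext'|exact: alg'].
pose ev1 : {rmorphism MP k d.+1 -> B} := evalX ev x.
have i1 c : ev1 (MPC k d.+1 c) = iota c by rewrite /ev1 /= evalXC.
have [d' [ev' [dd' inj' i' alg' ext']]] := IH d.+1 ev1 x_inj i1.
exists d', ev'; split=> //; first exact: ltnW.
  move=> b; rewrite inE => /predU1P[->|]; last exact: alg'.
  apply: ext'; exists ('X - ('X : {poly MP k d})%:P); split; first by rewrite polyXsubC_eq0.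
  by rewrite rmorphB /= evalX_X evalXC /ev1 /= evalX_X subrr.
move=> b [q [q0 qb]]; apply: ext'; exists (map_poly polyC q); split.
  by rewrite map_poly_eq0_id0 // polyC_eq0 lead_coef_eq0.
rewrite evalXE -map_poly_comp -[RHS]qb evalXE; congr (_.[_]).
by apply: eq_map_poly => c /=; rewrite /ev1 /= evalXC.
Qed.

(** Once the independent elements are enlarged to a transcendence basis, the generators of [B]
    become integral over a polynomial ring with one denominator inverted, and
    [prime_chain_above] applies. *)
Lemma trdeg_le_krull n d (ev : {rmorphism MP k d -> B}) :
    char0 k -> affine iota -> is_krull_dim B n ->
    (forall p, ev p = 0 -> p = 0) -> (forall c, ev (MPC k d c) = iota c) ->
  (d <= n)%N.
Proof.
move=> hk [m [x Bx]] [_ dimB] ev_inj0 ev_iota0.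
have [d' [e [dd' e_inj e_iota alg_e _]]] :=
  transcendental_extension [seq x i | i : 'I_m] ev_inj0 ev_iota0.
apply: leq_trans dd' (dimB _ _); clear ev ev_inj0 ev_iota0.
have algx i : algebraic e (x i) by apply: alg_e; apply: map_f; rewrite mem_enum.
have [q qP] := choice algx.
pose s := \prod_i lead_coef (q i).
have s0 : s != 0 by apply/prodf_neq0 => i _; rewrite lead_coef_eq0; have [] := qP i.
have int_b b : exists N, integralOver e (e s ^+ N * b).
  have [p ->] := Bx b.
  apply: (mmap_closed (P := fun b => exists N, integralOver e (e s ^+ N * b)))
    => [c|i|u v [N uN] [N' vN']|u v [N uN] [N' vN']].
  - by exists 0%N; rewrite expr0 mul1r -e_iota; apply: integral_id.
  - exists 1%N; rewrite expr1 /s (bigD1 i) //= rmorphM /= mulrAC.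
    apply: integral_mul (integral_id _ _); have [qi0 qx] := qP i.
    apply: integral_lead_coef => //; rewrite ltnNge; apply/negP => /size1_polyC qC.
    move: qx qi0; rewrite qC evalXC => /e_inj ->; by rewrite eqxx.
  - exists (N + N')%N; rewrite mulrDr; apply: integral_add.
      rewrite exprD mulrAC mulrC; apply: integral_mul => //.
      by rewrite -rmorphXn; apply: integral_id.
    rewrite exprD -mulrA; apply: integral_mul => //.
    by rewrite -rmorphXn; apply: integral_id.
  - by exists (N + N')%N; rewrite exprD mulrACA; apply: integral_mul.
have [Q QE] := zero_prime B.
have [|b|C [Cc _]] := prime_chain_above hk (Q := Q) (ev := e) s0; last by exists C.
  by move=> p /QE /e_inj.
have [N [p p_mon pb]] := int_b b.
exists (p \Po (s ^+ N *: 'X)), (N * (size p).-1)%N; split.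
  have sX : size (s ^+ N *: 'X : {poly MP k d'}) = 2 by rewrite size_scale ?expf_neq0 ?size_polyX.
  rewrite lead_coef_comp ?sX // (monicP p_mon) mul1r lead_coefZ lead_coefX mulr1.
  by rewrite exprM.
apply/QE; rewrite map_comp_poly map_polyZ map_polyX horner_comp hornerZ hornerX.
by rewrite rmorphXn; apply/eqP.
Qed.
End TrDeg.

Section ChainIndep.
Variables (k : fieldType) (A : comNzRingType) (iota : {rmorphism k -> A}).

(** The variables are elements that separate consecutive primes. In a relation modulo the lowest
    prime, the constant term with respect to the outermost variable is a relation modulo the next
    prime, hence zero; the relation can then be divided by that variable. *)
Lemma chain_indep d (C : nat -> prime_idealr A) : prime_chain d C ->
  exists ev : {rmorphism MP k d -> A},
    (forall c, ev (MPC k d c) = iota c) /\ (forall p, ev p \in C 0%N -> p = 0).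
Proof.
elim: d C => [|d IH] C Cc.
  exists iota; split=> // p pC; apply/eqP/negPn/negP => p0.
  suff : (1 : A) \in C 0%N by rewrite idealr1.
  by rewrite -(rmorph1 iota) -(mulVf p0) rmorphM idealMr.
have [|ev' [ev'C ev'_inj]] := IH (fun i => C i.+1); first by move=> i; apply: (Cc i.+1).
have [C01 [y yC1 yC0]] := Cc 0%N isT.
pose ev : {rmorphism {poly MP k d} -> A} := evalX ev' y.
exists ev; split=> [c|p]; first by rewrite /ev /= evalXC.
change {poly MP k d} in (type of p).
have [n] := ubnP (size p); elim: n p => // n IHn p szp pC0.
have p00 : root p 0.
  apply/eqP/ev'_inj; rewrite -(evalXC ev' y) -[evalX _ _ _](subKr (ev p)) rpredB //.
    exact: C01.
  have /factor_theorem[r rE] : root (p - p.[0]%:P) 0 by rewrite /root !hornerE subrr.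
  by rewrite -rmorphB rE subr0 rmorphM /= evalX_X idealMr.
have [q qE] := factor_theorem _ _ p00; rewrite subr0 in qE.
move: pC0; rewrite qE rmorphM /= evalX_X prime_idealrM (negbTE yC0) orbF => qC0.
have [->|q0] := eqVneq q 0; first by rewrite mul0r.
rewrite (IHn q) ?mul0r //.
by move: szp; rewrite qE size_mulX.
Qed.
End ChainIndep.

Lemma rmorph_mmap (k A B : comNzRingType) n (g : {rmorphism A -> B})
    (f : {rmorphism k -> A}) (h : 'I_n -> A) (f' : {rmorphism k -> B}) h' p :
    (forall c, g (f c) = f' c) -> (forall i, g (h i) = h' i) ->
  g (mmap f h p) = mmap f' h' p.
Proof.
move=> fE hE; rewrite /mmap rmorph_sum /=; apply: eq_bigr => m _.
rewrite rmorphM fE /mmap1 rmorph_prod /=; congr (_ * _); apply: eq_bigr => i _.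
by rewrite rmorphXn hE.
Qed.

Section MPvars.
Variable k : fieldType.

Fixpoint MPX d : nat -> MP k d :=
  match d return nat -> MP k d with
  | 0 => fun=> 0
  | d'.+1 => fun i => if i == d' then ('X : {poly MP k d'}) else (MPX d' i)%:P
  end.

Fixpoint MPev (A : comNzRingType) (f : {rmorphism k -> A}) (y : nat -> A) d :
    {rmorphism MP k d -> A} :=
  match d return {rmorphism MP k d -> A} with
  | 0 => f
  | d'.+1 => evalX (MPev f y d') (y d')
  end.

Lemma MPevC A f y d c : @MPev A f y d (MPC k d c) = f c.
Proof. by elim: d => //= d IH; rewrite evalXC. Qed.

Lemma MPevX A f y d i : (i < d)%N -> @MPev A f y d (MPX d i) = y i.
Proof.
elim: d => //= d IH; rewrite ltnS leq_eqVlt.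
case: eqP => [-> _|_ /IH e]; first by rewrite evalX_X.
by rewrite evalXC.
Qed.

Definition mpoly_to_MP d : {rmorphism {mpoly k[d]} -> MP k d} :=
  mmap (MPC k d) (fun i : 'I_d => MPX d i).

Definition MP_to_mpoly d : {rmorphism MP k d -> {mpoly k[d]}} :=
  MPev (@mpolyC d k) (fun i => if insub i is Some j then 'X_j else 0) d.

Lemma mpoly_to_MPK d : cancel (mpoly_to_MP d) (MP_to_mpoly d).
Proof.
move=> p; rewrite /mpoly_to_MP.
rewrite (rmorph_mmap (f' := @mpolyC d k) (h' := tnth [tuple 'X_i | i < d])).
- exact: comp_mpoly_id.
- exact: MPevC.
- by move=> i; rewrite /MP_to_mpoly MPevX // valK tnth_mktuple.
Qed.
End MPvars.

Section Counting.
Variable k : fieldType.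

Lemma msizeM_leS n (p q : {mpoly k[n]}) a b :
  (msize p <= a.+1)%N -> (msize q <= b.+1)%N -> (msize (p * q) <= (a + b).+1)%N.
Proof.
have [->|p0] := eqVneq p 0; first by rewrite mul0r msize0.
have [->|q0] := eqVneq q 0; first by rewrite mulr0 msize0.
move=> pa qb; rewrite msizeM //.
by apply: (@leq_trans (a.+1 + b.+1).-1); [rewrite -!subn1 leq_sub2r // leq_add|rewrite addnS].
Qed.

Lemma msize_mmap1_le m n (z : 'I_m -> {mpoly k[n]}) D (u : 'X_{1..m}) :
  (forall i, msize (z i) <= D.+1)%N -> (msize (mmap1 z u) <= (mdeg u * D).+1)%N.
Proof.
move=> zD; rewrite /mmap1 mdegE big_distrl /=.
elim/big_ind2: _ => [|p a q b|i _]; [by rewrite msize1|exact: msizeM_leS|].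
elim: (u i) => [|e IH]; first by rewrite expr0 msize1.
by rewrite exprS mulSn; apply: msizeM_leS.
Qed.

(** The products of powers of [z] with exponents below [N] are [N ^ m] elements of a space of
    dimension at most [(c * N) ^ n], with [c] independent of [N]. *)
Lemma mpoly_dependent m n (z : 'I_m -> {mpoly k[n]}) : (n < m)%N ->
  exists2 p : {mpoly k[m]}, p != 0 & mmap (@mpolyC n k) z p = 0.
Proof.
move=> nm; pose D := \max_i msize (z i).
have zD i : (msize (z i) <= D.+1)%N by apply/leqW; apply: leq_bigmax.
pose c := (m * D).+1; pose N := (c ^ n).+1; pose M := (m * N * D).+1.
have MN : (M ^ n < N ^ m)%N.
  have le : (M <= c * N)%N.
    by rewrite /M /c mulSn mulnAC -add1n leq_add2r.
  apply: (@leq_ltn_trans ((c * N) ^ n)); first by case: (n) => // n'; rewrite leq_exp2r.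
  rewrite expnMn; apply: (@leq_trans (N ^ n.+1)); last by rewrite leq_pexp2l.
  by rewrite expnS ltn_pmul2r // expn_gt0.
pose I := {ffun 'I_m -> 'I_N}; pose J := {ffun 'I_n -> 'I_M}.
pose mI (a : I) : 'X_{1..m} := [multinom (a i : nat) | i < m].
pose mJ (a : J) : 'X_{1..n} := [multinom (a i : nat) | i < n].
pose X : 'M[k]_(#|I|, #|J|) :=
  \matrix_(i, j) (mmap1 z (mI (enum_val i)))@_(mJ (enum_val j)).
have kX : kermx X != 0.
  rewrite -mxrank_eq0 mxrank_ker subn_eq0 -ltnNge.
  apply: leq_ltn_trans (rank_leq_col X) _.
  by rewrite !card_ffun !card_ord.
pose v := nz_row (kermx X).
have v0 : v != 0 by rewrite nz_row_eq0.
have vX : v *m X = 0 by apply/sub_kermxP; apply: nz_row_sub.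
have mI_inj : injective mI.
  move=> a b /mnmP e; apply/ffunP => i; apply: val_inj.
  by have := e i; rewrite !mnmE.
exists (\sum_i v 0 i *: 'X_[mI (enum_val i)]).
  have [i vi] : exists i, v 0 i != 0.
    apply: contrapT => /forallNP h; case/negP: v0; apply/eqP/rowP => i.
    by rewrite mxE; apply/eqP/negPn/negP/h.
  apply: contraNneq vi => /(congr1 (fun p => p@_(mI (enum_val i)))).
  rewrite mcoeff0 linear_sum (bigD1 i) //= big1 => [|j ji]; last first.
    rewrite mcoeffZ mcoeffX; case: eqP => [/mI_inj/enum_val_inj e|]; last by rewrite mulr0.
    by rewrite e eqxx in ji.
  by rewrite mcoeffZ mcoeffX eqxx mulr1 addr0 => ->.
apply/mpolyP => u; rewrite rmorph_sum /= mcoeff0.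
under eq_bigr do rewrite mmapZ mmapX mul_mpolyC.
rewrite linear_sum /=.
have [uM|/existsP[j]] := boolP [forall j, u j < M]%N; last first.
  rewrite -leqNgt => Mu; apply: big1 => i _; rewrite mcoeffZ.
  rewrite [X in _ * X]memN_msupp_eq0 ?mulr0 //; apply: msize_mdeg_ge.
  apply: leq_trans (msize_mmap1_le _ zD) (leq_trans _ (leq_trans Mu _)); last first.
    by rewrite mdegE (bigD1 j) //= leq_addr.
  rewrite ltnS leq_mul2r mdegE; apply/orP; right.
  rewrite -[X in (_ <= X * _)%N]card_ord -sum_nat_const; apply: leq_sum => l _.
  by rewrite mnmE ltnW.
pose a : J := [ffun j => Ordinal (forallP uM j)].
have := congr1 (fun w : 'rV[k]_#|J| => w 0 (enum_rank a)) vX; rewrite !mxE => vXa.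
rewrite -[RHS]vXa; apply: eq_bigr => i _; rewrite mcoeffZ mxE enum_rankK.
by congr (_ * mcoeff _ _); apply/mnmP => j; rewrite mnmE ffunE.
Qed.
End Counting.

(** A chain of length [m] gives [m] algebraically independent elements of a quotient of a
    polynomial ring in [n] variables, hence of that polynomial ring. *)
Lemma chain_le_gens (k : fieldType) (A : comNzRingType) (iota : {rmorphism k -> A}) n
    (x : 'I_n -> A) m (C : nat -> prime_idealr A) :
    (forall b, exists q, b = mmap iota x q) -> prime_chain m C -> (m <= n)%N.
Proof.
move=> Ax /(chain_indep iota)[ev [evC ev_inj]]; rewrite leqNgt; apply/negP => nm.
have [z zE] := choice (fun i : 'I_m => Ax (ev (MPX k m i))).
have [p p0 pz] := mpoly_dependent z nm.
case/negP: p0; rewrite -(can_eq (@mpoly_to_MPK k m)) rmorph0; apply/eqP.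
apply: ev_inj; rewrite /mpoly_to_MP.
rewrite (rmorph_mmap (f' := iota) (h' := fun i : 'I_m => ev (MPX k m i))) //.
rewrite -(rmorph_mmap (g := mmap iota x) (f := @mpolyC n k) (h := z)) //.
  by rewrite pz rmorph0 idealr0.
by move=> c; rewrite /= mmapC.
Qed.

(** * The Koszul complex *)

Definition span (R : comNzRingType) (y : nat -> R) j (r : R) :=
  exists b : nat -> R, r = \sum_(i < j) b i * y i.

Section Span.
Variables (R : comNzRingType) (y : nat -> R).

Lemma span0 j : span y j 0.
Proof. by exists (fun=> 0); rewrite big1 // => i _; rewrite mul0r. Qed.

Lemma spanD j a u v : span y j u -> span y j v -> span y j (a * u + v).
Proof.
move=> [b ->] [c ->]; exists (fun i => a * b i + c i).
by rewrite mulr_sumr -big_split /=; apply: eq_bigr => i _; rewrite mulrDl mulrA.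
Qed.

Lemma spanS j u : span y j.+1 u <-> exists a v, span y j v /\ u = v + a * y j.
Proof.
split=> [[b ->]|[a [v [[b ->] ->]]]].
  by exists (b j), (\sum_(i < j) b i * y i); split; [exists b | rewrite big_ord_recr].
exists (fun i => if i == j then a else b i); rewrite big_ord_recr /= eqxx.
by congr (_ + _); apply: eq_bigr => i _; rewrite ltn_eqF.
Qed.
End Span.

Definition regular_family (R : comNzRingType) (y : nat -> R) n :=
  forall j r, (j < n)%N -> span y j (y j * r) -> span y j r.

Section Koszul.
Variables (R : comNzRingType).

(** The Koszul complex, as an iterated mapping cone: the pair [(x, y)] stands for [x + e /\ y],
    where [e] is the generator of the exterior algebra attached to the last element. *)
Fixpoint kos n : lmodType R :=
  if n is n'.+1 then ((kos n' * kos n')%type : lmodType R) else (R^o : lmodType R).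

Fixpoint kd (th : nat -> R) n : kos n -> kos n :=
  match n return kos n -> kos n with
  | 0 => fun=> 0
  | n'.+1 => fun x : (kos n' * kos n')%type =>
      (kd th x.1 + th n' *: x.2, - kd th x.2)
  end.

(** Left multiplication by the element [\sum_i c i e_i] of degree one. *)
Fixpoint kh (c : nat -> R) n : kos n -> kos n :=
  match n return kos n -> kos n with
  | 0 => fun=> 0
  | n'.+1 => fun x : (kos n' * kos n')%type => (kh c x.1, c n' *: x.1 - kh c x.2)
  end.

(** Homogeneity of degree [i]; zero is homogeneous of every degree. *)
Fixpoint kdeg i n : kos n -> Prop :=
  match n return kos n -> Prop with
  | 0 => fun x => i = 0%N \/ x = 0
  | n'.+1 => fun x : (kos n' * kos n')%type =>
      kdeg i x.1 /\ if i is i'.+1 then kdeg i' x.2 else x.2 = 0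
  end.

Fixpoint kin (J : R -> Prop) n : kos n -> Prop :=
  match n return kos n -> Prop with
  | 0 => fun x : R => J x
  | n'.+1 => fun x : (kos n' * kos n')%type => kin J x.1 /\ kin J x.2
  end.

Fixpoint k0 (u : R) n : kos n :=
  match n return kos n with
  | 0 => (u : R^o)
  | n'.+1 => ((k0 u n', 0) : (kos n' * kos n')%type)
  end.

(** The element [\sum_i b i e_i]. *)
Fixpoint k1 (b : nat -> R) n : kos n :=
  match n return kos n with
  | 0 => 0
  | n'.+1 => ((k1 b n', k0 (b n') n') : (kos n' * kos n')%type)
  end.

Section Ops.
Variables th c : nat -> R.

Lemma kd_lin n a (x y : kos n) : kd th (a *: x + y) = a *: kd th x + kd th y.
Proof.
elim: n x y => [|n IH] /=; first by rewrite scaler0 addr0.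
move=> [x1 x2] [y1 y2] /=; rewrite !IH; congr (_, _); last by rewrite /= opprD scalerN.
by rewrite /= !scalerDr !scalerA [th n * a]mulrC addrACA.
Qed.

Lemma kd0 n : kd th (0 : kos n) = 0.
Proof. by have := kd_lin (-1) (0 : kos n) 0; rewrite addr0 scaler0 scaleN1r addNr. Qed.

Lemma kdN n (x : kos n) : kd th (- x) = - kd th x.
Proof. by have := kd_lin (-1) x 0; rewrite kd0 !addr0 !scaleN1r. Qed.

Lemma kdB n (x y : kos n) : kd th (x - y) = kd th x - kd th y.
Proof. by rewrite addrC -scaleN1r kd_lin scaleN1r addrC. Qed.

Lemma kdZ n a (x : kos n) : kd th (a *: x) = a *: kd th x.
Proof. by have := kd_lin a x 0; rewrite kd0 !addr0. Qed.

Lemma kd_kd n (x : kos n) : kd th (kd th x) = 0.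
Proof.
elim: n x => [//|n IH] [x1 x2] /=; rewrite kdN IH oppr0.
have -> : kd th (kd th x1 + th n *: x2) = th n *: kd th x2.
  by rewrite addrC kd_lin IH addr0.
by rewrite scalerN subrr oppr0.
Qed.

Lemma kh_lin n a (x y : kos n) : kh c (a *: x + y) = a *: kh c x + kh c y.
Proof.
elim: n x y => [|n IH] /=; first by rewrite scaler0 addr0.
move=> [x1 x2] [y1 y2] /=; rewrite !IH; congr (_, _).
by rewrite /= !scalerDr !scalerA [c n * a]mulrC scalerN opprD addrACA.
Qed.

(** Left multiplication by a one-form is a homotopy from zero to the multiplication by the
    value of [d] on that form. *)
Lemma kh_kd n (x : kos n) :
  kd th (kh c x) + kh c (kd th x) = (\sum_(i < n) c i * th i) *: x.
Proof.
elim: n x => [|n IH]; first by move=> x; rewrite big_ord0 scale0r /= addr0.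
move=> [x1 x2]; rewrite big_ord_recr /=.
have e1 := IH x1; have e2 := IH x2.
rewrite [kd th x1 + _]addrC kh_lin kdB kdZ.
have -> : kh c (- kd th x2) = - kh c (kd th x2).
  have := kh_lin (-1) (kd th x2) 0; rewrite !addr0 !scaleN1r => ->.
  by rewrite [kh c 0]( _ : _ = 0) ?addr0 //; have := kh_lin (-1) (0 : kos n) 0;
    rewrite addr0 scaler0 scaleN1r addNr.
set s := \sum_(i < n) _ in e1 e2 *.
rewrite [in RHS]/GRing.scale /=; congr (_, _).
  rewrite /= scalerDl -e1 scalerBr scalerA [th n * c n]mulrC.
  by rewrite !addrA subrK addrAC.
rewrite /= scalerDl -e2 scalerDr scalerA opprB opprK.
by rewrite [X in _ + (X + _)]addrC !addrA subrK addrAC.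
Qed.
End Ops.
End Koszul.

Section KoszulDegree.
Variables (R : comNzRingType).

Lemma kdeg0 i n : kdeg i (0 : kos R n).
Proof. by elim: n i => [|n IH] i /=; [right | split=> //; case: i => // i]. Qed.

Lemma kdeg_lin i n a (x y : kos R n) : kdeg i x -> kdeg i y -> kdeg i (a *: x + y).
Proof.
elim: n i x y => [|n IH] i x y /=.
  by move=> [?|->] [?|->]; [left|left|left|right; rewrite scaler0 addr0].
move=> [x1 x2] [y1 y2]; split; first exact: IH.
case: i x1 x2 y1 y2 => [|i] _ x2 _ y2; last exact: IH.
by rewrite /= x2 y2 scaler0 addr0.
Qed.

Lemma kdegZ i n a (x : kos R n) : kdeg i x -> kdeg i (a *: x).
Proof. by move=> h; rewrite -[_ *: _]addr0; apply: kdeg_lin (kdeg0 _ _). Qed.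

Lemma kdegN i n (x : kos R n) : kdeg i x -> kdeg i (- x).
Proof. by rewrite -scaleN1r; apply: kdegZ. Qed.

Lemma kdegD i n (x y : kos R n) : kdeg i x -> kdeg i y -> kdeg i (x + y).
Proof. by move=> hx hy; rewrite -[x]scale1r; apply: kdeg_lin. Qed.

Lemma kdeg_gt i n (x : kos R n) : (n < i)%N -> kdeg i x -> x = 0.
Proof.
elim: n i x => [|n IH] [|i] x //=; first by move=> _ [].
rewrite ltnS => ni [/IH x1 /IH x2]; case: x x1 x2 => x1 x2 /= e1 e2.
by rewrite e1 ?e2 // ltnW.
Qed.

Lemma kdeg0P n (x : kos R n) : kdeg 0 x -> exists u, x = k0 u n.
Proof.
elim: n x => [|n IH] x; first by exists x.
by case: x => x1 x2 [/IH[u /= ->] /= ->]; exists u.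
Qed.

Lemma kd_k0 (th : nat -> R) u n : kd th (k0 u n) = 0.
Proof. by elim: n => //= n ->; rewrite kd0 oppr0 scaler0 addr0. Qed.

Lemma kdeg_kd (th : nat -> R) i n (x : kos R n) : kdeg i.+1 x -> kdeg i (kd th x).
Proof.
elim: n i x => [|n IH] i x /=; first by right.
move=> [x1 x2]; split; first by apply: kdegD; [exact: IH | exact: kdegZ].
case: i x1 x2 => [|i] x1 x2; last by apply: kdegN; apply: IH.
by have [u ->] := kdeg0P x2; rewrite kd_k0 oppr0.
Qed.

Lemma kdeg_kh (c : nat -> R) i n (x : kos R n) : kdeg i x -> kdeg i.+1 (kh c x).
Proof.
elim: n i x => [|n IH] i x /=; first by right.
move=> [x1 x2]; split; first exact: IH.
apply: kdegD; first exact: kdegZ.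
apply: kdegN; case: i x1 x2 => [|i] _ x2; last exact: IH.
rewrite x2; have -> : kh c (0 : kos R n) = 0; last exact: kdeg0.
by have := kh_lin c (-1) (0 : kos R n) 0; rewrite addr0 scaler0 scaleN1r addNr.
Qed.

End KoszulDegree.

Section Acyclic.
Variables (R : comNzRingType).

Definition is_ideal (J : R -> Prop) := J 0 /\ forall a u v, J u -> J v -> J (a * u + v).

Lemma kin_lin J n a (x y : kos R n) : is_ideal J -> kin J x -> kin J y -> kin J (a *: x + y).
Proof.
move=> hJ; elim: n x y => [|n IH] x y /=; first by apply: hJ.2.
by move=> [x1 x2] [y1 y2]; split; apply: IH.
Qed.

Lemma kin0 J n : is_ideal J -> kin J (0 : kos R n).
Proof. by move=> hJ; elim: n => [|n IH] //=; apply: hJ.1. Qed.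

Lemma kinB J n (x y : kos R n) : is_ideal J -> kin J x -> kin J y -> kin J (x - y).
Proof. by move=> hJ hx hy; rewrite addrC -scaleN1r; apply: kin_lin. Qed.

Lemma kinD J n (x y : kos R n) : is_ideal J -> kin J x -> kin J y -> kin J (x + y).
Proof. by move=> hJ hx hy; rewrite -[x]scale1r; apply: kin_lin. Qed.

Lemma kinZ J n a (x : kos R n) : is_ideal J -> kin J x -> kin J (a *: x).
Proof. by move=> hJ hx; rewrite -[_ *: _]addr0; apply: kin_lin => //; apply: kin0. Qed.

Lemma kin_kd J th n (x : kos R n) : is_ideal J -> kin J x -> kin J (kd th x).
Proof.
move=> hJ; elim: n x => [|n IH] x /=; first by move=> _; apply: hJ.1.
move=> [x1 x2]; split; first by apply: kinD => //; [apply: IH | apply: kinZ].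
by rewrite -scaleN1r; apply: kinZ => //; apply: IH.
Qed.

Lemma kin_kh J c n (x : kos R n) : is_ideal J -> kin J x -> kin J (kh c x).
Proof.
move=> hJ; elim: n x => [|n IH] x /=; first by move=> _; apply: hJ.1.
move=> [x1 x2]; split; first exact: IH.
by apply: kinB => //; [apply: kinZ | apply: IH].
Qed.

Lemma kin_cancel J y n (x : kos R n) :
  (forall r, J (y * r) -> J r) -> kin J (y *: x) -> kin J x.
Proof.
move=> hy; elim: n x => [|n IH] x /=; first exact: hy.
by move=> [x1 x2]; split; apply: IH.
Qed.

Lemma kin_spanS (y : nat -> R) j i n (x : kos R n) :
  kin (span y j.+1) x -> kdeg i x ->
  exists v, kdeg i v /\ kin (span y j) (x - y j *: v).
Proof.
elim: n i x => [|n IH] i x /=.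
  move=> xS [->|->]; last first.
    by exists 0; split; [right | rewrite scaler0 subr0; apply: span0].
  have [a [v [vS ->]]] := (spanS _ _ _).1 xS; exists a; split; first by left.
  by rewrite [_ *: _]mulrC addrK.
move=> [x1 x2] [d1 d2]; have [v1 [dv1 hv1]] := IH i x.1 x1 d1.
have [v2 [dv2 hv2]] : exists v : kos R n,
    (if i is i'.+1 then kdeg i' v else v = 0) /\ kin (span y j) (x.2 - y j *: v).
  case: i {d1 dv1} d2 => [e|i d2]; last exact: IH.
  exists 0; split=> //; rewrite e scaler0 subr0; apply: kin0.
  by split; [exact: span0 | move=> ? ? ?; exact: spanD].
by exists (v1, v2).
Qed.

Lemma span_ideal (y : nat -> R) j : is_ideal (span y j).
Proof. by split; [exact: span0 | move=> ? ? ?; exact: spanD]. Qed.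

(** Depth sensitivity of the Koszul complex: multiplication by [y j] is null-homotopic, so that
    each regular element [y j] kills one more homology group, starting from the top degree. *)
Lemma koszul_acyclic (th y : nat -> R) n j i (x : kos R n) :
    regular_family y n -> (forall j, (j < n)%N -> span th n (y j)) ->
    (j <= n)%N -> (j < i)%N -> kdeg i x -> kin (span y j) (kd th x) ->
  exists z, kdeg i.+1 z /\ kin (span y j) (x - kd th z).
Proof.
move=> y_reg y_th; move: i x; have [m] := ubnP (n - j); elim: m j => // m IH j mj i x jn ji dx hx.
have spI l := span_ideal y l.
move: jn; rewrite leq_eqVlt => /predU1P[jn|jn].
  exists 0; split; first exact: kdeg0.
  by rewrite (kdeg_gt _ dx) -?jn // kd0 subrr; apply: kin0.
have [c yE] := y_th j jn.
have hom := kh_kd th c x; rewrite -yE in hom.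
have hx1 : kin (span y j.+1) (kd th (kh c x)).
  have -> : kd th (kh c x) = y j *: x - kh c (kd th x) by rewrite -hom addrK.
  apply: kinB => //.
    elim: (n) (x) => [|n' IHn] x' /=; last by split; apply: IHn.
    by apply/spanS; exists x', 0; rewrite add0r [x' * _]mulrC; split=> //; apply: span0.
  apply: kin_kh => //; move: hx; elim: (n) (kd th x) => [|n' IHn] x' /=.
    by move=> h; apply/spanS; exists 0, x'; rewrite mul0r addr0.
  by move=> [h1 h2]; split; apply: IHn.
have [||z [dz hz]] := IH j.+1 _ i.+1 (kh c x) jn _ (kdeg_kh c dx) hx1.
- by rewrite -ltnS; apply: leq_trans mj; rewrite ltnS ltn_sub2l.
- by rewrite ltnS.
have [v [dv hv]] := kin_spanS hz (kdegD (kdeg_kh c dx) (kdegN (kdeg_kd th dz))).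
exists v; split=> //; apply: (@kin_cancel _ (y j)) => [r|]; first exact: y_reg.
have := kin_kd th (spI j) hv; rewrite !kdB kd_kd subr0 kdZ => hv'.
have -> : y j *: (x - kd th v) = (kd th (kh c x) - y j *: kd th v) + kh c (kd th x).
  by rewrite scalerBr -hom addrAC.
by apply: kinD => //; apply: kin_kh.
Qed.

Lemma k0_lin a u v n : a *: k0 u n + k0 v n = k0 (a * u + v) n :> kos R n.
Proof.
elim: n => [//|n IH] /=; rewrite -IH.
by congr (_, _); rewrite /= scaler0 addr0.
Qed.

Lemma k00 n : k0 (0 : R) n = 0.
Proof. by elim: n => //= n ->. Qed.

Lemma kd_k1 (th b : nat -> R) n : kd th (k1 b n) = k0 (\sum_(i < n) b i * th i) n.
Proof.
elim: n => [|n IH]; first by rewrite big_ord0.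
rewrite /= IH kd_k0 oppr0 big_ord_recr /=; congr (_, _).
by rewrite [LHS]addrC k0_lin addrC [b n * _]mulrC.
Qed.

Lemma kdeg_k0 u n : kdeg 0 (k0 u n : kos R n).
Proof. by elim: n => [|n IH] /=; [left|]. Qed.

Lemma kdeg_k1 b n : kdeg 1 (k1 b n : kos R n).
Proof. by elim: n => [|n IH] /=; [right|split=> //; apply: kdeg_k0]. Qed.

Lemma k1_ext b b' n : (forall i, (i < n)%N -> b i = b' i) -> k1 b n = k1 b' n :> kos R n.
Proof.
elim: n => //= n IH h; rewrite h // IH // => i ni.
by apply: h; apply: ltnW.
Qed.

Lemma kdeg1P n (x : kos R n) : kdeg 1 x -> exists b, x = k1 b n.
Proof.
elim: n x => [|n IH] x /=; first by case=> // ->; exists (fun=> 0).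
case: x => x1 x2 /= [/IH[b ->] /kdeg0P[u ->]].
exists (fun i => if i == n then u else b i); rewrite eqxx; congr (_, _).
by apply: k1_ext => i ni; rewrite ltn_eqF.
Qed.

Lemma k0_inj n : injective (fun u : R => k0 u n).
Proof. by elim: n => [|n IH] u v //= [] /IH. Qed.

Lemma kin_eq0 J n (x : kos R n) : (forall r, J r -> r = 0) -> kin J x -> x = 0.
Proof.
move=> hJ; elim: n x => [|n IH] x /=; first exact: hJ.
by case: x => x1 x2 [/IH /= -> /IH /= ->].
Qed.

(** A relation between the [n + 1] generators is a cycle of degree one. As the first homology
    vanishes it is a boundary, whose last coefficient is a combination of the other
    generators. *)
Lemma regular_last_generator (th y : nat -> R) n u :
    regular_family y n.+1 -> (forall j, (j < n.+1)%N -> span th n.+1 (y j)) ->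
  span th n (th n * u) -> span th n u.
Proof.
move=> y_reg y_th [b bE].
pose x : kos R n.+1 := (- k1 b n, k0 u n).
have dx : kdeg 1 x by split; [apply/kdegN/kdeg_k1 | apply: kdeg_k0].
have hx : kd th x = 0.
  rewrite /= kdN kd_k1 -bE kd_k0 oppr0; congr (_, _).
  have -> : k0 (th n * u) n = th n *: k0 u n :> kos R n.
    by rewrite -[RHS]addr0 -(k00 n) k0_lin addr0.
  by rewrite addNr.
have := @koszul_acyclic th y n.+1 0 1 x y_reg y_th isT isT dx.
case=> [|[z1 z2] [[_ dz2] /kin_eq0 e]].
  by rewrite hx; apply: kin0 (span_ideal y 0).
have {e}/(congr1 snd)/= e : x = kd th ((z1, z2) : kos R n.+1).
  by apply/eqP; rewrite -subr_eq0; apply/eqP/e => r [c ->]; rewrite big_ord0.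
have [b' /= z2E] := kdeg1P dz2.
exists (fun i => - b' i); apply: (@k0_inj n).
rewrite e z2E kd_k1 -scaleN1r -[LHS]addr0 -[X in _ + X](k00 n) k0_lin addr0 mulN1r -sumrN.
by congr (k0 _ n); apply: eq_bigr => i _; rewrite mulNr.
Qed.
End Acyclic.

(** * Complete intersections *)

(** The coefficients of [r] are read off those of [p * r] from the top degree downwards. *)
Lemma monic_mul_ideal (R : comNzRingType) (J : R -> Prop) (p r : {poly R}) :
    J 0 -> (forall a u v, J u -> J v -> J (a * u + v)) -> p \is monic ->
  (forall l, J (p * r)`_l) -> forall l, J r`_l.
Proof.
move=> J0 JD /monicP p1 pr; suff H n l : (size r <= l + n)%N -> J r`_l.
  by move=> l; apply: (H (size r)); rewrite leq_addl.
elim: n l => [|n IH] l; first by rewrite addn0 => h; rewrite nth_default.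
move=> sr; set e := (size p).-1.
have := pr (e + l)%N; rewrite coefM (bigD1 (inord e)) //= inordK ?ltnS ?leq_addr //.
rewrite -/(lead_coef p) p1 mul1r addKn => Jpr.
have JN u : J u -> J (- u) by move=> Ju; rewrite -mulN1r -[_ * _]addr0; apply: JD.
have Jadd u v : J u -> J v -> J (u + v) by move=> Ju Jv; rewrite -[u]mul1r; apply: JD.
rewrite -[r`_l](addrK (\sum_(i < (e + l).+1 | i != inord e) p`_i * r`_(e + l - i))).
apply: (Jadd) => //; apply: JN; apply: big_ind => // i ie.
have [lt|gt|eq] := ltngtP i e.
- by rewrite -[_ * _]addr0; apply: JD => //; apply: IH; lia.
- by rewrite [p`_i]nth_default ?mul0r // (leq_trans (leqSpred _)).
- by case/eqP: ie; apply: val_inj; rewrite /= inordK // ltnS leq_addr.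
Qed.

Section MonicFamily.
Variables (k : fieldType) (p : nat -> {poly k}).

Definition MPvar d i : MP k d := evalX (MPC k d) (MPX k d i) (p i).

Lemma MPvar_lt d i : (i < d)%N -> MPvar d.+1 i = (MPvar d i)%:P.
Proof.
move=> id; rewrite /MPvar /= ltn_eqF // !evalXE -[RHS]horner_map /=; congr (_.[_]).
by rewrite -map_poly_comp.
Qed.

Lemma span_const (R : comNzRingType) (y : nat -> R) (y' : nat -> {poly R}) j r :
  (forall i, (i < j)%N -> y' i = (y i)%:P) ->
  span y' j r <-> forall l, span y j r`_l.
Proof.
move=> yy'; split=> [[b ->] l|h].
  rewrite coef_sum; exists (fun i => (b i)`_l); apply: eq_bigr => i _.
  by rewrite yy' // coefMC.
have [b bE] := choice h.
exists (fun i => \poly_(l < size r) b l i); apply/polyP => l.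
rewrite coef_sum; under eq_bigr => i _ do rewrite yy' // coefMC coef_poly.
case: ltnP => lr; last by rewrite nth_default // big1 // => i _; rewrite mul0r.
exact: bE.
Qed.

(** The polynomials in the inner variables are constants in the last variable, in which the
    last polynomial is monic. *)
Lemma monic_regular d : (forall i, p i \is monic) -> regular_family (MPvar d) d.
Proof.
move=> p_mon; elim: d => // d IH j r; change {poly MP k d} in (type of r).
rewrite ltnS leq_eqVlt => /predU1P[->|jd].
  have yy' i : (i < d)%N -> MPvar d.+1 i = (MPvar d i)%:P by apply: MPvar_lt.
  rewrite !(span_const _ yy').
  apply: monic_mul_ideal; [exact: span0 | move=> ? ? ?; exact: spanD |].
  rewrite /MPvar /= eqxx evalXE map_poly_comp -[_.['X]]/(_ \Po 'X) comp_polyXr.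
  exact: monic_map.
have yy' i : (i < j)%N -> MPvar d.+1 i = (MPvar d i)%:P.
  by move=> ij; apply: MPvar_lt; apply: ltn_trans jd.
rewrite !(span_const _ yy') MPvar_lt // => h l.
by apply: IH => //; rewrite -coefCM.
Qed.
End MonicFamily.

(** In [k[X_1, ..., X_n]] the ideal generated by the [p] relations [f] and by lifts of [a] and
    [c] contains a monic polynomial in each variable, because [B / (a, c)] is algebraic over [k].
    These [n] polynomials form a regular sequence, and [p + 2 <= n] because a chain of length [p]
    below the ideal of relations continues with a chain of length 2 of [B]. *)
Lemma complete_intersection_regular (k : fieldType) (B : idomainType)
    (iota : {rmorphism k -> B}) (a c u w : B) :
    complete_intersection iota -> is_krull_dim B 2 ->
    (forall b, exists p : {poly k}, p \is monic /\
       exists s t, (map_poly iota p).[b] = s * a + t * c) ->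
    c * u = a * w -> exists v, u = v * a.
Proof.
move=> [n [f [I [phi [If [[C Cc CI] _] phi_bij phiC]]]]] [[C' C'c] _] intB cu_aw.
pose G : {rmorphism {mpoly k[n]} -> B} := phi \o \pi_{ideal_quot I}%qT.
have G_surj b : exists q, b = G q.
  have [psi psiK phiK] := phi_bij.
  by exists (repr (psi b)); rewrite /G /= reprK phiK.
have G0 q : G q = 0 <-> ideal_gen f q.
  rewrite -If; split=> [|qI].
    rewrite -(rmorph0 phi) => /(bij_inj phi_bij) e.
    have : \pi_{ideal_quot I}%qT q == 0 by apply/eqP.
    by rewrite -(rmorph0 \pi_{ideal_quot I}%qT) piE Quotient.equivE subr0.
  rewrite /G /=; have -> : \pi_{ideal_quot I}%qT q = 0; last exact: rmorph0.
  apply/eqP; rewrite -(rmorph0 \pi_{ideal_quot I}%qT).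
  by rewrite piE Quotient.equivE subr0.
(* the chain below I followed by the preimage of a chain of B *)
have le_n : ((size f).+2 <= n)%N.
  have [Q QE] := choice (fun j => prime_preim G (C' j)).
  pose E i := if (i <= size f)%N then C i else Q (i - size f)%N.
  apply: (@chain_le_gens k {mpoly k[n]} (@mpolyC n k) n (fun i => 'X_i) _ E).
    move=> q; exists q; rewrite -[LHS]comp_mpoly_id.
    rewrite /comp_mpoly /mmap; apply: eq_bigr => m _; congr (_ * _).
    by apply: mmap1_eq => i; rewrite tnth_mktuple.
  move=> i lti; rewrite /E; have [ltf|gtf|->] := ltngtP i (size f).
  - by apply: Cc.
  - rewrite subSn ?(ltnW gtf) //.
    have [sub [x xin xout]] : prime_lt (C' (i - size f)%N) (C' (i - size f).+1).
      by apply: C'c; lia.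
    split=> [q /QE/sub qin|]; first exact/QE.
    have [q xE] := G_surj x; exists q; first by apply/QE; rewrite -xE.
    by apply/negP => /QE; rewrite -xE; apply/negP.
  rewrite subSnn; have [sub [x xin xout]] := C'c 0%N isT.
  split=> [q|].
    rewrite CI => /If/G0 q0; apply/QE; rewrite q0; exact: idealr0.
  have [q xE] := G_surj x; exists q; first by apply/QE; rewrite -xE.
  rewrite CI; apply/negP => /If/G0; rewrite -xE => x0.
  by rewrite x0 idealr0 in xout.
have [[a' aE] [c' cE]] := (G_surj a, G_surj c); have [[u' uE] [w' wE]] := (G_surj u, G_surj w).
have [p pP] := choice (fun i => intB (G (if insub i is Some j then 'X_j : {mpoly k[n]} else 0))).
have p_mon i : p i \is monic by have [] := pP i.
pose sg : {rmorphism {mpoly k[n]} -> MP k n} := mpoly_to_MP k n.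
(* the generators, ordered so that the lift of c comes last *)
pose th i := if i == (size f).+1 then sg c' else if i == size f then sg a' else sg f`_i.
have th_f i : (i < size f)%N -> th i = sg f`_i.
  by move=> h; rewrite /th !ltn_eqF // ltnW.
have th_a : th (size f) = sg a' by rewrite /th eqxx ltn_eqF.
have th_c : th (size f).+1 = sg c' by rewrite /th eqxx.
have spf q : ideal_gen f q -> span th (size f) (sg q).
  move=> [b ->]; exists (fun i => sg (b i)); rewrite rmorph_sum /=.
  by apply: eq_bigr => i _; rewrite rmorphM th_f.
have y_reg : regular_family (MPvar p n) (size f).+2.
  by move=> j r jf; apply: monic_regular => //; apply: leq_trans le_n.
have y_th j : (j < (size f).+2)%N -> span th (size f).+2 (MPvar p n j).
  move=> jf; have jn : (j < n)%N by apply: leq_trans le_n.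
  have [_ [s [t]]] := pP j; rewrite insubT => e.
  have [s' sE] := G_surj s; have [t' tE] := G_surj t.
  pose P := evalX (@mpolyC n k) 'X_(Ordinal jn) (p j).
  have sgP : sg P = MPvar p n j.
    rewrite /P /MPvar !evalXE -horner_map /= -map_poly_comp; congr (_.[_]).
      by apply: eq_map_poly => x /=; rewrite /sg /mpoly_to_MP /= mmapC.
    by rewrite /sg /mpoly_to_MP /= mmapX mmap1U.
  have GP : G P = s * a + t * c.
    rewrite -e /P evalXE -horner_map /= -map_poly_comp; congr (_.[_]).
    by apply: eq_map_poly => x; rewrite -phiC.
  rewrite -sgP; apply/spanS; exists (sg t'), (sg (P - t' * c')).
  rewrite th_c -rmorphM -rmorphD subrK; split=> //.
  apply/spanS; exists (sg s'), (sg (P - t' * c' - s' * a')).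
  rewrite th_a -rmorphM -rmorphD subrK; split=> //; apply: spf; apply/G0.
  by rewrite !rmorphB !rmorphM GP -aE -cE -sE -tE; ring.
have [] := regular_last_generator (u := sg u') y_reg y_th.
  apply/spanS; exists (sg w'), (sg (c' * u' - w' * a')).
  rewrite th_a th_c -!rmorphM -rmorphD subrK; split=> //.
  by apply/spf/G0; rewrite rmorphB !rmorphM -aE -cE -uE -wE cu_aw mulrC subrr.
move=> b; rewrite big_ord_recr /= th_a => /(congr1 (MP_to_mpoly k n)).
rewrite mpoly_to_MPK rmorphD rmorphM mpoly_to_MPK => /(congr1 G).
rewrite -uE rmorphD rmorphM -aE => uE'.
exists (G (MP_to_mpoly k n (b (size f)))); rewrite uE'.
rewrite [X in X + _](_ : _ = 0) ?add0r //; apply/G0.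
exists (fun i => MP_to_mpoly k n (b i)); rewrite rmorph_sum; apply: eq_bigr => i _.
by rewrite rmorphM th_f // mpoly_to_MPK.
Qed.

(** * Locally nilpotent derivations *)

Section Derivation.
Variables (B : idomainType) (D : B -> B) (hD : derivation D).

Let DD : {morph D : x y / x + y}. Proof. by case: hD. Qed.
Let DM x y : D (x * y) = D x * y + x * D y. Proof. by case: hD. Qed.

Lemma der0 : D 0 = 0.
Proof. by apply: (addIr (D 0)); rewrite -DD !add0r. Qed.

Lemma derN x : D (- x) = - D x.
Proof. by apply/eqP; rewrite -addr_eq0 -DD addNr der0. Qed.

Lemma derB x y : D (x - y) = D x - D y. Proof. by rewrite DD derN. Qed.

Lemma der1 : D 1 = 0.
Proof. by have := DM 1 1; rewrite !mulr1 mul1r -{1}[D 1]addr0 => /addrI. Qed.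

Lemma derV x : x \is a GRing.unit -> D x = 0 -> D x^-1 = 0.
Proof.
move=> ux Dx; have := DM x x^-1; rewrite divrr // der1 Dx mul0r add0r => /esym/eqP.
by rewrite mulf_eq0 => /orP[/eqP x0|/eqP //]; rewrite x0 unitr0 in ux.
Qed.

Definition ker_pred : {pred B} := fun x => D x == 0.

Lemma ker_divring_closed : divring_closed ker_pred.
Proof.
split; first by apply/eqP/der1.
  by move=> x y /eqP Dx /eqP Dy; apply/eqP; rewrite derB Dx Dy subr0.
move=> x y /eqP Dx /eqP Dy; apply/eqP; rewrite DM Dx mul0r add0r.
have [uy|nuy] := boolP (y \is a GRing.unit); first by rewrite derV // mulr0.
by rewrite invr_out // Dy mulr0.
Qed.

HB.instance Definition _ :=
  GRing.isDivringClosed.Build B ker_pred ker_divring_closed.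

Record ker_ring := KerRing { ker_val :> B; _ : ker_val \in ker_pred }.
HB.instance Definition _ := [isSub for ker_val].
HB.instance Definition _ := [Choice of ker_ring by <:].
HB.instance Definition _ := [SubChoice_isSubIntegralDomain of ker_ring by <:].

Lemma derivation_kernel : exists (A : idomainType) (j : {rmorphism A -> B}),
  injective j /\ forall b, D b = 0 <-> exists a, b = j a.
Proof.
exists ker_ring, (\val : {rmorphism ker_ring -> B}); split; first exact: val_inj.
move=> b; split=> [/eqP Db|[[a /= /eqP aP] ->]] //.
by exists (KerRing Db).
Qed.

Lemma derX x n : D (x ^+ n) = x ^+ n.-1 *+ n * D x.
Proof.
elim: n => [|n IH]; first by rewrite expr0 der1 mulr0n mul0r.
rewrite exprS DM IH; case: n {IH} => [|n]; first by rewrite expr0; ring.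
by rewrite /= [in RHS]mulrS exprS; ring.
Qed.

End Derivation.

Section Kernel.
Variables (A B : idomainType) (j : {rmorphism A -> B}) (D : B -> B).
Hypotheses (j_inj : injective j) (hD : LND D) (hB : char0 B).
Hypothesis (Dj : forall a, D (j a) = 0).

Let DD x y : D (x + y) = D x + D y. Proof. by case: hD => -[]. Qed.
Let DM x y : D (x * y) = D x * y + x * D y. Proof. by case: hD => -[]. Qed.

Lemma char0_kernel : char0 A.
Proof.
move=> n; apply/negP => /eqP/(congr1 j); rewrite rmorph0 rmorph_nat => /eqP.
by apply/negP/hB.
Qed.

Lemma exists_slice b : D b != 0 -> exists r, D r != 0 /\ D (D r) = 0.
Proof.
move=> Db; have [n] := hD.2 b; elim: n => [|n IH] in b Db *.
  by move=> /= b0; move: Db; rewrite b0 (der0 hD.1) eqxx.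
rewrite iterSr; have [Db0|DDb] := eqVneq (D (D b)) 0; first by exists b.
exact: IH.
Qed.

Lemma der_evalX b p : D (evalX j b p) = evalX j b p^`() * D b.
Proof.
elim/poly_ind: p => [|p c IH]; first by rewrite deriv0 !rmorph0 (der0 hD.1) mul0r.
rewrite derivMXaddC !rmorphD !rmorphM /= evalX_X evalXC DD DM IH Dj addr0.
by ring.
Qed.

(** Differentiating an algebraic relation lowers its degree. *)
Lemma transcendental_over_kernel b p : D b != 0 -> evalX j b p = 0 -> p = 0.
Proof.
move=> Db; have [n] := ubnP (size p); elim: n p => // n IH p sz e.
have p'0 : p^`() = 0.
  have [->|p0] := eqVneq p 0; first exact: deriv0.
  apply: IH; first by apply: leq_trans (lt_size_deriv p0) _.
  apply/eqP; have := der_evalX b p; rewrite e (der0 hD.1) => /esym/eqP.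
  by rewrite mulf_eq0 (negbTE Db) orbF.
have pC : p = (p`_0)%:P.
  apply/polyP => i; rewrite coefC; case: i => [//|i] /=.
  have /polyP/(_ i) := p'0; rewrite coef_deriv coef0 => /eqP.
  by rewrite -mulr_natr mulf_eq0 (negbTE (char0_kernel i)) orbF => /eqP.
by move: e; rewrite pC evalXC -(rmorph0 j) => /j_inj ->.
Qed.

Lemma iter_der_const a b n : iter n D (j a * b) = j a * iter n D b.
Proof. by elim: n => //= n ->; rewrite DM Dj mul0r add0r. Qed.

Lemma iter_derB b c n : iter n D (b - c) = iter n D b - iter n D c.
Proof. by elim: n => //= n ->; rewrite (derB hD.1). Qed.

Lemma iter_derX r w n : D r = j w -> iter n D (r ^+ n) = j (n`!%:R * w ^+ n).
Proof.
move=> Dr; elim: n => [|n IH]; first by rewrite fact0 mulr1 rmorph1.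
rewrite iterSr (derX hD.1) Dr /= -mulr_natl mulrAC -(rmorph_nat j) -rmorphM.
rewrite iter_der_const IH -rmorphM factS natrM exprS; congr (j _); ring.
Qed.

(** Subtracting a suitable multiple of [r ^ n] from a multiple of [b] lowers the order of
    nilpotency of [b], since [D ^ n] maps [r ^ n] to [n! (D r) ^ n]. *)
Lemma slice_expansion r b : (forall b, D b = 0 -> exists a, b = j a) -> D r != 0 -> D (D r) = 0 ->
  exists u p, u != 0 /\ j u * b = evalX j r p.
Proof.
move=> j_ker Dr /j_ker[w wE]; have w0 : w != 0.
  by apply: contraNneq Dr => w0; rewrite wE w0 rmorph0.
have [n] := hD.2 b; elim: n => [|n IH] in b *.
  by move=> /= ->; exists 1, 0; rewrite oner_eq0 rmorph0 mulr0.
rewrite iterS => /j_ker[g gE]; pose al : A := n`!%:R * w ^+ n.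
have al0 : al != 0.
  by rewrite mulf_neq0 ?expf_neq0 // -[n`!]prednK ?fact_gt0 //; apply: char0_kernel.
have [|u [p [u0 e]]] := IH (j al * b - j g * r ^+ n).
  by rewrite iter_derB !iter_der_const gE (iter_derX _ wE) -/al mulrC subrr.
exists (u * al), (p + (u * g)%:P * 'X^n); split; first exact: mulf_neq0.
rewrite rmorphD /= -e (rmorphM (evalX j r)) /= (rmorphXn (evalX j r)) /= evalX_X evalXC.
by rewrite !rmorphM /=; ring.
Qed.
End Kernel.

(** * Gauss's lemma *)

Section PrimeContent.
Variables (R : comNzRingType) (P : R -> Prop).
Hypotheses (P0 : P 0) (PD : forall a u v, P u -> P v -> P (a * u + v)).
Hypothesis PM : forall u v, P (u * v) -> P u \/ P v.

(** The product of the lowest coefficients outside [P] is, modulo [P], a coefficient of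
    [C * D]. *)
Lemma prime_content (C D : {poly R}) : (forall l, P (C * D)`_l) ->
  (forall l, P C`_l) \/ (forall l, P D`_l).
Proof.
move=> CD; apply: contrapT => /not_orP[/existsNP hC /existsNP hD].
have exC : exists i, `[< ~ P C`_i >] by case: hC => i h; exists i; apply/asboolP.
have exD : exists i, `[< ~ P D`_i >] by case: hD => i h; exists i; apply/asboolP.
case: (ex_minnP exC) => i /asboolP Ci Cmin; case: (ex_minnP exD) => l /asboolP Dl Dmin.
have Padd u v : P u -> P v -> P (u + v) by rewrite -{2}[u]mul1r; apply: PD.
have PN u : P u -> P (- u) by move=> h; rewrite -mulN1r -[_ * _]addr0; apply: PD.
have Pl u v : P v -> P (u * v) by move=> h; rewrite -[_ * _]addr0; apply: PD.
have := CD (i + l)%N; rewrite coefM (bigD1 (inord i)) //= inordK ?ltnS ?leq_addr // addKn.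
set S := (X in _ + X) => h; have : P (C`_i * D`_l).
  rewrite -[_ * _](addrK S); apply: (Padd) => //; apply: PN; rewrite /S.
  apply: big_ind => // m mi.
  have [lt|gt|eq] := ltngtP m i.
  - rewrite mulrC; apply: Pl; apply: contrapT => h'.
    by have := Cmin m; rewrite leqNgt lt; apply/implyP/negP => -[]; apply/asboolP.
  - apply: Pl; apply: contrapT => h'; have /Dmin : `[< ~ P D`_(i + l - m) >] by apply/asboolP.
    by move: (ltn_ord m); lia.
  - by case/eqP: mi; apply: val_inj; rewrite /= inordK // ltnS leq_addr.
by case/PM.
Qed.
End PrimeContent.

(** A non-constant factor of least degree is prime. *)
Lemma exists_prime_factor (F : fieldType) (c : {poly F}) : (1 < size c)%N ->
  exists p : {poly F}, [/\ (1 < size p)%N, p %| c &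
    forall u v, p %| u * v -> p %| u \/ p %| v].
Proof.
move=> c1.
have ex : exists n, `[< exists p : {poly F}, [/\ (1 < size p)%N, p %| c & size p = n] >].
  by exists (size c); apply/asboolP; exists c.
case: (ex_minnP ex) => n /asboolP[p [p1 pc pn]] nmin.
exists p; split=> // u v puv; have [pu|npu] := boolP (p %| u); first by left.
right; have p0 : p != 0 by rewrite -size_poly_gt0 ltnW.
rewrite -(Gauss_dvdpr (d := p) (q := u) v) //; rewrite /coprimep.
have g0 : gcdp p u != 0 by rewrite gcdp_eq0 (negbTE p0).
have gp : gcdp p u %| p by apply: dvdp_gcdl.
case: (ltngtP (size (gcdp p u)) 1) => // g1.
  by move: g1; rewrite ltnS leqn0 size_poly_eq0 (negbTE g0).
case/negP: npu.
have /nmin : `[< exists q : {poly F}, [/\ (1 < size q)%N, q %| c & size q = size (gcdp p u)] >].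
  by apply/asboolP; exists (gcdp p u); split=> //; apply: dvdp_trans pc.
rewrite -pn => szp; have : gcdp p u %= p.
  by rewrite -dvdp_size_eqp // eqn_leq szp dvdp_leq.
by move=> /eqp_dvdl <-; apply: dvdp_gcdr.
Qed.

Section Gauss.
Variables (F M : fieldType) (psi : {rmorphism {poly F} -> M}).
Hypothesis psi_inj : injective psi.
Hypothesis psi_frac : forall m, exists p q, q != 0 /\ m = psi p / psi q.

Let psi0 p : (psi p == 0) = (p == 0).
Proof. by rewrite -(rmorph0 psi) (inj_eq psi_inj). Qed.

Let denom (H : {poly M}) c := c != 0 /\ exists C, map_poly psi C = psi c *: H.

Lemma exists_denom H : exists c, denom H c.
Proof.
elim/poly_ind: H => [|H m [c [c0 [C CE]]]].
  by exists 1; split; [exact: oner_neq0 | exists 0; rewrite rmorph0 scaler0].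
have [p [q [q0 ->]]] := psi_frac m.
exists (c * q); split; first exact: mulf_neq0.
exists (q%:P * C * 'X + (c * p)%:P).
have q0' : psi q != 0 by rewrite psi0.
have e : psi (c * p) = psi (c * q) * (psi p / psi q) by rewrite !rmorphM; field.
rewrite rmorphD !(rmorphM (map_poly psi)) /= !map_polyC map_polyX /= CE -!mul_polyC e.
by rewrite polyCM [psi (c * q)]rmorphM polyCM; ring.
Qed.

Lemma exists_min_denom H : exists c, denom H c /\ forall c', denom H c' -> (size c <= size c')%N.
Proof.
have ex : exists n, `[< exists c, denom H c /\ size c = n >].
  by have [c hc] := exists_denom H; exists (size c); apply/asboolP; exists c.
case: (ex_minnP ex) => n /asboolP[c [hc cn]] nmin; exists c; split=> // c' hc'.
by rewrite cn; apply: nmin; apply/asboolP; exists c'.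
Qed.

Lemma denom_div H c C (p : {poly F}) : map_poly psi C = psi c *: H -> c != 0 -> (1 < size p)%N ->
  H \is monic -> (forall l, p %| C`_l) -> exists c', denom H c' /\ (size c' < size c)%N.
Proof.
move=> CE c0 p1 Hmon pC.
have pp0 : p != 0 by rewrite -size_poly_gt0 ltnW.
have cE : c = C`_(size H).-1.
  apply: psi_inj; rewrite -coef_map CE coefZ -[_`__]/(lead_coef H) (monicP Hmon).
  by rewrite mulr1.
have pc : p %| c by rewrite cE.
exists (c %/ p); split; last first.
  by rewrite size_divp // ltn_subrL size_poly_gt0 c0 andbT -ltnS prednK // ltnW.
split; first by rewrite dvdp_div_eq0.
exists (map_poly (fun x => x %/ p) C).
apply: (scalerI (a := psi p)); first by rewrite psi0.
rewrite scalerA -rmorphM mulrC divpK // -CE.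
apply/polyP => l; rewrite coefZ !coef_map_id0 ?div0p ?rmorph0 //.
by rewrite -rmorphM mulrC divpK.
Qed.

(** A prime factor of a least common denominator of [H] would divide all the coefficients of
    [c H] or of [d H'], contradicting the minimality of [c] or of [d]. *)
Lemma gauss_monic_factor (H H' : {poly M}) (G : {poly {poly F}}) :
    H \is monic -> H' \is monic -> map_poly psi G = H * H' ->
  exists H0, H = map_poly psi H0.
Proof.
move=> Hmon H'mon GE.
have [c [[c0 [C CE]] cmin]] := exists_min_denom H.
have [d [[d0 [D DE]] dmin]] := exists_min_denom H'.
have [/size1_polyC cC|c1] := leqP (size c) 1.
  have u0 : c`_0 != 0 by apply: contraNneq c0 => e; rewrite cC e.
  exists ((c`_0)^-1%:P%:P * C).
  move: u0 cC; set x := c`_0 => u0 cC.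
  rewrite rmorphM /= map_polyC /= CE cC -mul_polyC mulrA -polyCM -rmorphM -polyCM.
  by rewrite mulVf // rmorph1 polyC1 mul1r.
have [p [p1 pc pM]] := exists_prime_factor c1.
have CD : C * D = (c * d) *: G.
  apply: (map_inj_poly psi_inj (rmorph0 psi)).
  by rewrite rmorphM /= CE DE map_polyZ /= GE rmorphM -scalerAl -scalerAr scalerA.
have [||||pC|pD] := @prime_content _ (fun u => p %| u) _ _ _ C D.
- exact: dvdp0.
- by move=> a u v pu pv; rewrite dvdp_add // dvdp_mull.
- exact: pM.
- by move=> l; rewrite CD coefZ -mulrA dvdp_mulr.
- by have [c' [/cmin + lt]] := denom_div CE c0 p1 Hmon pC; rewrite leqNgt lt.
- by have [d' [/dmin + lt]] := denom_div DE d0 p1 H'mon pD; rewrite leqNgt lt.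
Qed.
End Gauss.

Lemma poly_frac_denom (R : idomainType) (p : {poly {fraction R}}) :
  exists u p', u != 0 /\ map_poly (@tofrac R) p' = tofrac u *: p.
Proof.
elim/poly_ind: p => [|p c [u [p' [u0 e]]]].
  by exists 1, 0; rewrite oner_neq0 rmorph0 scaler0.
have [s [t [t0 ->]]] := fracP c.
exists (u * t), (t%:P * p' * 'X + (u * s)%:P); split; first exact: mulf_neq0.
have t0' : tofrac t != 0 by rewrite tofrac_eq0.
have es : tofrac (u * s) = tofrac (u * t) * (tofrac s / tofrac t).
  by rewrite !tofracM -mulrA; congr (_ * _); rewrite mulrC divfK.
rewrite rmorphD !(rmorphM (map_poly _)) /= !map_polyC map_polyX /= e -!mul_polyC es.
have aux (C : comNzRingType) (T U Q Y S : C) :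
  T * (U * Q) * Y + U * T * S = U * T * (Q * Y + S) by ring.
by rewrite polyCM tofracM polyCM aux.
Qed.

Lemma frac_poly_ext (R : idomainType) (M : fieldType) (f : {rmorphism R -> M}) y :
  (forall p, evalX f y p = 0 -> p = 0) ->
  exists g : {rmorphism {fraction R} -> M},
    [/\ forall a, g (tofrac a) = f a,
        injective (evalX g y),
        forall p, evalX g y (map_poly (@tofrac R) p) = evalX f y p &
        forall p, exists u p', [/\ u != 0, map_poly (@tofrac R) p' = tofrac u *: p
                                 & f u * evalX g y p = evalX f y p']].
Proof.
move=> h; have f_inj : injective f.
  move=> a b e; apply/eqP; rewrite -subr_eq0 -polyC_eq0; apply/eqP/h.
  by rewrite evalXC rmorphB e subrr.
have [g gE] := frac_ext f_inj.
have eE p : evalX g y (map_poly (@tofrac R) p) = evalX f y p.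
  by rewrite !evalXE -map_poly_comp; congr (_.[_]); apply: eq_map_poly.
have den p : exists u p', [/\ u != 0, map_poly (@tofrac R) p' = tofrac u *: p
                                 & f u * evalX g y p = evalX f y p'].
  have [u [p' [u0 e]]] := poly_frac_denom p; exists u, p'; split=> //.
  by rewrite -eE e -mul_polyC rmorphM /= evalXC gE.
exists g; split=> // p q e; apply/eqP; rewrite -subr_eq0.
have [u [p' [u0 pE e']]] := den (p - q).
have p'0 : p' = 0 by apply: h; rewrite -e' rmorphB /= e subrr mulr0.
move: pE; rewrite p'0 rmorph0 => /esym/eqP.
by rewrite scaler_eq0 tofrac_eq0 (negbTE u0).
Qed.

Lemma poly_preim (R M : nzRingType) (f : {rmorphism R -> M}) (P : {poly M}) :
  (forall l, exists a, P`_l = f a) -> exists P0, P = map_poly f P0.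
Proof.
move=> /choice[a aE]; exists (\poly_(l < size P) a l); apply/polyP => l.
rewrite coef_map coef_poly; case: ltnP => [_|le]; first exact: aE.
by rewrite raddf0 nth_default.
Qed.

Section Conductor.
Variables (A B : idomainType) (j : {rmorphism A -> B}) (r : B).
Hypothesis r_tr : forall p, evalX j r p = 0 -> p = 0.
Hypothesis slice : forall b, exists u p, u != 0 /\ j u * b = evalX j r p.

(** Over the fraction field of [A] the ring [B] becomes a polynomial ring, which is integrally
    closed; clearing denominators moves an integral element into [B]. *)
Lemma kernel_conductor (x : {fraction B}) : integralOver (@tofrac B) x ->
  exists a b, a != 0 /\ tofrac (j a) * x = tofrac b.
Proof.
move=> [P Pmon Px].
pose f : {rmorphism A -> {fraction B}} := @tofrac B \o j.
have fE p : evalX f (tofrac r) p = tofrac (evalX j r p).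
  by rewrite !evalXE -horner_map -map_poly_comp.
have j0 a : j a = 0 -> a = 0.
  by move=> a0; apply/eqP; rewrite -polyC_eq0; apply/eqP/r_tr; rewrite evalXC.
have [|g [gE psi_inj psiE den]] := @frac_poly_ext A {fraction B} f (tofrac r).
  by move=> p; rewrite fE => /eqP; rewrite tofrac_eq0 => /eqP/r_tr.
pose psi : {rmorphism {poly {fraction A}} -> {fraction B}} := evalX g (tofrac r).
have psi_B b : exists p, tofrac b = psi p.
  have [u [p [u0 e]]] := slice b.
  exists ((tofrac u)^-1%:P * map_poly (@tofrac A) p).
  rewrite rmorphM /= psiE fE -e evalXC fmorphV gE /= tofracM mulKf //.
  by rewrite tofrac_eq0; apply: contraNneq u0 => /j0 ->.
have psi_frac m : exists p q, q != 0 /\ m = psi p / psi q.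
  have [b [c [c0 ->]]] := fracP m.
  have [[p ->] [q e]] := (psi_B b, psi_B c); exists p, q; rewrite e; split=> //.
  by apply: contraNneq c0 => q0; rewrite -tofrac_eq0 e q0 rmorph0.
have [G GE] : exists G, map_poly (@tofrac B) P = map_poly psi G.
  by apply: poly_preim => l; rewrite coef_map; apply: psi_B.
have /factor_theorem[H' H'E] := Px.
have H'mon : H' \is monic.
  rewrite -(monicMr _ (monicXsubC x)) -H'E; exact: monic_map.
have [|H0 H0E] := gauss_monic_factor psi_inj psi_frac (monicXsubC x) H'mon (G := G).
  by rewrite -GE H'E mulrC.
have xE : x = psi (- H0`_0).
  by rewrite rmorphN -coef_map -H0E coefB coefX coefC /= sub0r opprK.
have [u [p' [u0 _ e]]] := den (- H0`_0).
by exists u, (evalX j r p'); rewrite -fE -e -xE.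
Qed.
End Conductor.

(** * Elements integral over both k(a)[c] and k(c)[a] *)

Section Bivariate.
Variables (k K : fieldType) (i : {rmorphism k -> K}) (a c : K).

Notation S := {poly {poly k}}.

Definition eval2 (x y : K) : {rmorphism S -> K} := evalX (evalX i x) y.

(** Integrality over [k(x)[y]], for [x] transcendental over [k]: the only possible [g] is then
    the isomorphism of the rational functions with [k(x)]. *)
Definition integral_over_line (x y b : K) :=
  forall g : {rmorphism {fraction {poly k}} -> K},
    (forall p, g (tofrac p) = evalX i x p) -> integralOver (evalX g y) b.

(** Once [v] is made monic, division by [v(Y)] over [k[X]] shows that [u(X)] divides [s]: this
    is why [k(x)[y]] and [k(y)[x]] meet in [k[x, y]]. *)
Lemma mem_bipoly (s t : S) (u v : {poly k}) : u != 0 -> v != 0 ->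
  s * map_poly polyC v = t * u%:P -> exists q, s = q * u%:P.
Proof.
move=> u0 v0; wlog vmon : v t v0 / v \is monic.
  move=> W e; set l := lead_coef v; have l0 : l != 0 by rewrite lead_coef_eq0.
  apply: (W (l^-1%:P * v) (t * l^-1%:P%:P)).
  - by rewrite mulf_neq0 // polyC_eq0 invr_eq0.
  - by rewrite monicE lead_coefM lead_coefC mulVf.
  - by rewrite rmorphM /= map_polyC /= mulrCA e; ring.
move=> e; pose w := map_poly (@polyC k) v.
have wmon : w \is monic by apply: monic_map.
have tE := Pdiv.RingMonic.rdivp_eq wmon t.
have szr : (size (Pdiv.Ring.rmodp t w) < size w)%N.
  by apply: Pdiv.Ring.ltn_rmodpN0; apply: monic_neq0.
exists (Pdiv.Ring.rdivp t w); apply/eqP; rewrite -subr_eq0; apply: contraTT szr => d0.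
have : (s - Pdiv.Ring.rdivp t w * u%:P) * w = u%:P * Pdiv.Ring.rmodp t w.
  rewrite mulrBl -/w in e *; rewrite e {1}tE; ring.
move/(congr1 (fun p : S => size p)).
rewrite size_Mmonic // size_Cmul // => <-.
by rewrite -leqNgt -subn1 -addnBAC ?size_poly_gt0 // leq_addl.
Qed.

Hypothesis ac_indep : forall p, eval2 a c p = 0 -> p = 0.

(** By Gauss's lemma the minimal polynomial of [b] over the field [k(a, c)] has its coefficients
    in [k(a)[c]] and in [k(c)[a]], hence in [k[a, c]]. *)
Lemma bivariate_minpoly b :
    integral_over_line a c b -> integral_over_line c a b ->
  exists H : {poly S}, [/\ H \is monic, evalX (eval2 a c) b H = 0 &
    forall G, evalX (eval2 a c) b G = 0 -> G != 0 -> (size H <= size G)%N].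
Proof.
move=> int1 int2; pose L := {fraction S}.
have th_inj : injective (eval2 a c).
  by move=> p q e; apply/eqP; rewrite -subr_eq0; apply/eqP/ac_indep; rewrite rmorphB /= e subrr.
have [la laE] := frac_ext th_inj.
(* the two intermediate rings, inside L *)
pose f1 : {rmorphism {poly k} -> L} := @tofrac S \o polyC.
pose f2 : {rmorphism {poly k} -> L} := @tofrac S \o map_poly polyC.
have f1E p : evalX f1 (tofrac ('X : S)) p = tofrac p.
  by rewrite evalXE (map_poly_comp (@tofrac S)) horner_map -[_.['X]]/(_ \Po 'X) comp_polyXr.
have f2E p : evalX f2 (tofrac ('X%:P : S)) p = tofrac (swapXY p).
  by rewrite evalXE (map_poly_comp (@tofrac S)) horner_map [swapXY]unlock.
have [|g1 [g1E inj1 psi1E den1]] := @frac_poly_ext {poly k} L f1 (tofrac ('X : S)).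
  by move=> p; rewrite f1E => /eqP; rewrite tofrac_eq0 => /eqP.
have [|g2 [g2E inj2 psi2E den2]] := @frac_poly_ext {poly k} L f2 (tofrac ('X%:P : S)).
  by move=> p; rewrite f2E => /eqP; rewrite tofrac_eq0 swapXY_eq0 => /eqP.
pose psi1 : {rmorphism {poly {fraction {poly k}}} -> L} := evalX g1 (tofrac ('X : S)).
pose psi2 : {rmorphism {poly {fraction {poly k}}} -> L} := evalX g2 (tofrac ('X%:P : S)).
have frac1 m : exists p q, q != 0 /\ m = psi1 p / psi1 q.
  have [p [q [q0 ->]]] := fracP m.
  exists (map_poly (@tofrac _) p), (map_poly (@tofrac _) q).
  rewrite /psi1 /= !psi1E !f1E; split=> //.
  by rewrite map_poly_eq0_id0 // tofrac_eq0 lead_coef_eq0.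
have frac2 m : exists p q, q != 0 /\ m = psi2 p / psi2 q.
  have [p [q [q0 ->]]] := fracP m.
  exists (map_poly (@tofrac _) (swapXY p)), (map_poly (@tofrac _) (swapXY q)).
  rewrite /psi2 /= !psi2E !f2E !swapXYK; split=> //.
  rewrite map_poly_eq0_id0 ?swapXY_eq0 // tofrac_eq0 lead_coef_eq0 swapXY_eq0 //.
have [P1 P1mon P1b] : integralOver (la \o psi1) b.
  have [|P Pmon Pb] := int1 (la \o g1).
    by move=> p; rewrite /= g1E /f1 /= laE /eval2 /= evalXC.
  exists P => //; move: Pb; rewrite /root; congr (_.[_] == _); apply: eq_map_poly => p.
  rewrite /psi1 /= !evalXE -horner_map laE /eval2 /= evalX_X -map_poly_comp.
  by congr (_.[_]); apply: eq_map_poly.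
have [P2 P2mon P2b] : integralOver (la \o psi2) b.
  have [|P Pmon Pb] := int2 (la \o g2).
    move=> p; rewrite /= g2E /f2 /= laE /eval2 /= evalXE -map_poly_comp.
    by rewrite evalXE; congr (_.[_]); apply: eq_map_poly => x /=; rewrite evalXC.
  exists P => //; move: Pb; rewrite /root; congr (_.[_] == _); apply: eq_map_poly => p.
  have laX : la (tofrac ('X%:P : S)) = a.
    by rewrite laE /eval2 /= evalXC; apply: evalX_X.
  rewrite /psi2 /= !evalXE -horner_map laX -map_poly_comp.
  by congr (_.[_]); apply: eq_map_poly.
have ex : exists n, `[< exists H : {poly L},
    [/\ H \is monic, root (map_poly la H) b & size H = n] >].
  exists (size (map_poly psi1 P1)); apply/asboolP; exists (map_poly psi1 P1).
  by split=> //; [exact: monic_map | rewrite -map_poly_comp].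
case: (ex_minnP ex) => n /asboolP[H [Hmon Hb Hn]] nmin.
have Hdvd (P : {poly L}) : root (map_poly la P) b -> H %| P.
  move=> Pb; rewrite /dvdp; apply/negPn/negP => r0.
  have szr : (size (P %% H)%R < size H)%N by rewrite ltn_modp monic_neq0.
  suff : (n <= size (P %% H)%R)%N by rewrite -Hn leqNgt szr.
  apply: nmin; apply/asboolP; exists ((lead_coef (P %% H))^-1 *: (P %% H)).
  have l0 : lead_coef (P %% H) != 0 by rewrite lead_coef_eq0.
  have li0 : (lead_coef (P %% H))^-1 != 0 by rewrite invr_eq0.
  split; last exact: size_scale li0.
    by apply/monicP; rewrite lead_coefZ; apply: (mulVf l0).
  have Hb0 : (map_poly la H).[b] = 0 by apply/eqP.
  have : (map_poly la P).[b] = 0 by apply/eqP.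
  rewrite {1}(divp_eq P H) rmorphD rmorphM /= hornerD hornerM Hb0 mulr0 add0r => e.
  by rewrite map_polyZ /root hornerZ e mulr0.
have coef1 P (psi : {rmorphism {poly {fraction {poly k}}} -> L}) :
    injective psi -> (forall m, exists p q, q != 0 /\ m = psi p / psi q) ->
    P \is monic -> root (map_poly (la \o psi) P) b -> exists H0, H = map_poly psi H0.
  move=> psi_inj psi_frac Pmon Pb.
  have Pmon' : map_poly psi P \is monic by apply: monic_map.
  have /dvdpP[Q QE] : H %| map_poly psi P by apply: Hdvd; rewrite -map_poly_comp.
  have Qmon : Q \is monic by rewrite -(monicMr _ Hmon) -QE.
  by apply: (gauss_monic_factor psi_inj psi_frac Hmon Qmon (G := P)); rewrite QE mulrC.
have [H1 H1E] := coef1 P1 psi1 inj1 frac1 P1mon P1b.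
have [H2 H2E] := coef1 P2 psi2 inj2 frac2 P2mon P2b.
have [HS HSE] : exists HS, H = map_poly (@tofrac S) HS.
  apply: poly_preim => l.
  have [u [p [u0 _ e1]]] := den1 H1`_l; have [v [q [v0 _ e2]]] := den2 H2`_l.
  have h1 : H`_l = evalX g1 (tofrac ('X : S)) H1`_l by rewrite H1E coef_map.
  have h2 : H`_l = evalX g2 (tofrac ('X%:P : S)) H2`_l by rewrite H2E coef_map.
  move: e1 e2; rewrite -h1 -h2 f1E f2E /f1 /f2 /= => e1 e2.
  have [w wE] : exists w, p = w * u%:P.
    apply: (@mem_bipoly p (swapXY q) u v) => //.
    apply/eqP; rewrite -tofrac_eq !tofracM -e1 -e2; apply/eqP.
    by rewrite mulrAC [RHS]mulrAC; congr (_ * _); apply: mulrC.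
  exists w; apply: (mulfI (x := tofrac u%:P)); first by rewrite tofrac_eq0 polyC_eq0.
  by rewrite e1 wE tofracM mulrC.
have szH : size H = size HS.
  by rewrite HSE size_map_inj_poly ?tofrac0 // => x y /eqP; rewrite tofrac_eq => /eqP.
have evH (P : {poly S}) : (map_poly la (map_poly (@tofrac S) P)).[b] = evalX (eval2 a c) b P.
  by rewrite -map_poly_comp evalXE; congr (_.[_]); apply: eq_map_poly.
exists HS; split.
- move: Hmon; rewrite !monicE HSE lead_coef_map_inj ?tofrac0 //; last first.
    by move=> x y /eqP; rewrite tofrac_eq => /eqP.
  by rewrite -tofrac1 tofrac_eq.
- by rewrite -evH -HSE; apply/eqP.
move=> G Gb G0; rewrite -szH.
have G0' : map_poly (@tofrac S) G != 0.
  by rewrite map_poly_eq0_id0 // tofrac_eq0 lead_coef_eq0.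
have /dvdp_leq : H %| map_poly (@tofrac S) G by apply: Hdvd; rewrite /root evH Gb.
by move=> /(_ G0') /leq_trans -> //; apply: size_poly.
Qed.
End Bivariate.

(** * Rings with trivial Makar-Limanov invariant *)

Section ClassM.
Variables (k : fieldType) (B : idomainType) (iota : {rmorphism k -> B}).
Hypotheses (hk : char0 k) (hB : classM iota).

Let aff : affine iota. Proof. by case: hB. Qed.
Let dimB : is_krull_dim B 2. Proof. by case: hB. Qed.
Let mlB b : ML b <-> exists c, b = iota c. Proof. by case: hB. Qed.
Let hcB : char0 B. Proof. exact: rmorph_char0 iota hk. Qed.

Lemma LND_const D c : LND D -> D (iota c) = 0.
Proof. by move=> hD; have /mlB := ex_intro (fun c' => iota c = iota c') c erefl; apply. Qed.

Lemma LND_evalX D z p : LND D -> D z = 0 -> D (evalX iota z p) = 0.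
Proof.
by move=> hD Dz; rewrite (der_evalX hD) ?Dz ?mulr0 // => c; apply: LND_const.
Qed.

Lemma nonconst_transcendental z : (forall c, z <> iota c) ->
  forall p, evalX iota z p = 0 -> p = 0.
Proof.
move=> zk; have /existsNP[D /not_implyP[hD /eqP Dz]] : ~ ML z by move/mlB => [c /zk].
move=> p; apply: (transcendental_over_kernel (fmorph_inj iota) hD hcB _ Dz).
by move=> c; apply: LND_const.
Qed.

(** Two algebraically independent elements of the kernel and an element outside the kernel would
    be three algebraically independent elements of a ring of dimension 2. *)
Lemma kernel_algebraic D z a : LND D -> (exists b, D b != 0) ->
  D z = 0 -> (forall c, z <> iota c) -> D a = 0 ->
  exists p : {poly {poly k}}, p != 0 /\ evalX (evalX iota z) a p = 0.
Proof.
move=> hD [r Dr] Dz zk Da; apply: contrapT => /evalX_inj a_tr.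
pose f : {rmorphism {poly {poly k}} -> B} := evalX (evalX iota z) a.
pose f3 : {rmorphism MP k 3 -> B} := evalX f r.
have f_inj : injective f.
  by move=> p q e; apply/eqP; rewrite -subr_eq0; apply/eqP/a_tr; rewrite rmorphB /= -/f e subrr.
have Df p : D (f p) = 0.
  rewrite (der_evalX hD) ?Da ?mulr0 // => q; exact: LND_evalX.
suff : (3 <= 2)%N by [].
apply: (trdeg_le_krull (ev := f3) hk aff dimB).
  by move=> p; apply: (transcendental_over_kernel f_inj hD hcB Df Dr).
by move=> c; rewrite /f3 /= evalXC /f /= evalXC; apply: evalXC.
Qed.

(** Otherwise [B] would be the image of [k], of dimension 0. *)
Lemma exists_LND : exists D : B -> B, LND D /\ exists b, D b != 0.
Proof.
apply: contrapT => noD; suff : (2 <= 0)%N by [].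
have [[C Cc] _] := dimB.
apply: (chain_le_gens (iota := iota) (x := fun i : 'I_0 => 0) _ Cc) => b.
suff /mlB[c ->] : ML b by exists c%:MP; rewrite mmapC.
move=> D hD; apply: contrapT => /eqP Db; apply: noD.
by exists D; split=> //; exists b.
Qed.

(** Otherwise [B] would be [k[r]] for a local slice [r], of dimension at most 1. *)
Lemma kernel_nonconst (D : B -> B) : LND D -> (exists b, D b != 0) ->
  exists a, D a = 0 /\ forall c, a <> iota c.
Proof.
move=> hD [b0 Db0]; apply: contrapT => h; suff : (2 <= 1)%N by [].
have ker b : D b = 0 -> exists c, b = iota c.
  move=> Db; apply: contrapT => /forallNP bk; apply: h; by exists b.
have [r [Dr DDr]] := exists_slice hD Db0.
have [[C Cc] _] := dimB.
apply: (chain_le_gens (iota := iota) (x := fun i : 'I_1 => r) _ Cc) => b.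
have [u [p [u0 e]]] :=
  slice_expansion hD hcB (fun c => LND_const c hD) b ker Dr DDr.
exists (evalX (@mpolyC 1 k) 'X_ord0 (u^-1%:P * p)).
have -> : mmap iota (fun=> r) (evalX (@mpolyC 1 k) 'X_ord0 (u^-1%:P * p)) =
   evalX iota r (u^-1%:P * p).
  rewrite !evalXE -horner_map -map_poly_comp /= mmapX mmap1U; congr (_.[_]).
  by apply: eq_map_poly => x; rewrite /= mmapC.
by rewrite rmorphM /= evalXC -e mulrA -rmorphM mulVf // rmorph1 mul1r.
Qed.

(** [D2] is chosen not to kill some non-constant [a] in the kernel of [D1]. As [a] is algebraic
    over [k(z)] for every non-constant [z] in the kernel of [D1], no such [z] is killed by
    [D2]. *)
Lemma two_LNDs : exists D1 D2 : B -> B,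
  [/\ LND D1, LND D2, exists b, D1 b != 0, exists b, D2 b != 0 &
      forall b, D1 b = 0 -> D2 b = 0 -> exists c, b = iota c].
Proof.
have [D1 [hD1 D1n]] := exists_LND.
have [a [D1a ak]] := kernel_nonconst hD1 D1n.
have /existsNP[D2 /not_implyP[hD2 /eqP D2a]] : ~ ML a by move/mlB => [c /ak].
exists D1, D2; split=> //; first by exists a.
move=> z D1z D2z; apply: contrapT => /forallNP zk.
have [p [p0 pa]] := kernel_algebraic hD1 D1n D1z zk D1a.
case/negP: p0; apply/eqP; apply: (transcendental_over_kernel _ hD2 hcB _ D2a pa).
  move=> q q' e; apply/eqP; rewrite -subr_eq0; apply/eqP.
  by apply: (nonconst_transcendental zk); rewrite rmorphB /= e subrr.
by move=> q; apply: LND_evalX.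
Qed.

Definition iotaK : {rmorphism k -> {fraction B}} := @tofrac B \o iota.

Lemma evalX_iotaK z p : evalX iotaK (tofrac z) p = tofrac (evalX iota z p).
Proof. by rewrite !evalXE -horner_map -map_poly_comp. Qed.

(** [B] lies in [Frac (ker D) [r]], where [r] is integral over [Frac (ker D) [c]] as soon as
    [D c != 0], and [Frac (ker D)] is algebraic over [k(a)]. *)
Lemma LND_integral_over_line D a c b : LND D ->
    D a = 0 -> (forall c, a <> iota c) -> D c != 0 ->
  integral_over_line iotaK (tofrac a) (tofrac c) (tofrac b).
Proof.
move=> hD Da ak Dc g gE.
have Dn : exists b, D b != 0 by exists c.
have [r [Dr DDr]] := exists_slice hD Dc.
have [A [j [j_inj jker]]] := derivation_kernel hD.1.
have Dj al : D (j al) = 0 by apply/jker; exists al.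
have slice b' := slice_expansion hD hcB Dj b' (fun b => proj1 (jker b)) Dr DDr.
set psi := evalX g (tofrac c).
have int_g y : integralOver g y -> integralOver psi y.
  move=> [p pmon py]; exists (map_poly polyC p); first exact: monic_map.
  rewrite -map_poly_comp; move: py; rewrite /root; congr (_.[_] == _).
  by apply: eq_map_poly => x /=; rewrite /psi evalXC.
have alg_j al : integralOver g (tofrac (j al)).
  have [p [p0 e]] := kernel_algebraic hD Dn Da ak (Dj al).
  apply/integral_algebraic; exists (map_poly (@tofrac _) p).
    by rewrite map_poly_eq0_id0 // tofrac_eq0 lead_coef_eq0.
  rewrite /root -map_poly_comp; move/(congr1 (@tofrac B)): e.
  rewrite rmorph0 evalXE -horner_map -map_poly_comp => e; apply/eqP.
  rewrite -[RHS]e; congr (_.[_]); apply: eq_map_poly => x.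
  by rewrite /= gE evalX_iotaK.
have j0 al : al != 0 -> tofrac (j al) != 0.
  by rewrite tofrac_eq0 -(rmorph0 j) (inj_eq j_inj).
have int_j al : integralOver psi (tofrac (j al)) by apply/int_g/alg_j.
have int_jV al : integralOver psi (tofrac (j al))^-1 by apply/int_g/integral_inv/alg_j.
have int_c : integralOver psi (tofrac c).
  by rewrite -[tofrac c](evalX_X g); apply: integral_id.
pose J : {rmorphism A -> {fraction B}} := @tofrac B \o j.
have evJ p : (map_poly J p).[tofrac r] = tofrac (evalX j r p).
  by rewrite evalXE -horner_map -map_poly_comp.
have int_r : integralOver psi (tofrac r).
  have [u [p [u0 e]]] := slice c.
  have szp : (1 < size p)%N.
    rewrite ltnNge; apply/negP => /size1_polyC pC.
    move/(congr1 D): e; rewrite pC evalXC Dj hD.1.2 Dj mul0r add0r => /eqP.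
    by rewrite mulf_eq0 (negbTE Dc) orbF -(rmorph0 j) (inj_eq j_inj) (negbTE u0).
  pose l := J (lead_coef p).
  have l0 : l != 0 by rewrite j0 // lead_coef_eq0 -size_poly_gt0 ltnW.
  pose Q := map_poly J p - (tofrac (j u) * tofrac c)%:P.
  have szJ : size (map_poly J p) = size p by rewrite size_map_poly_id0.
  have leadQ : lead_coef Q = l.
    rewrite lead_coefDl ?size_polyN ?szJ; first by rewrite lead_coef_map_eq.
    by apply: leq_ltn_trans (size_polyC_leq1 _) szp.
  apply: (@integral_root_monic _ _ psi _ (l^-1 *: Q)).
  - by rewrite monicE lead_coefZ leadQ mulVf.
  - by rewrite /root hornerZ hornerD hornerN hornerC evJ -tofracM e subrr mulr0.
  - apply/integral_poly => i; rewrite coefZ coefB coef_map coefC.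
    apply: integral_mul; first exact: int_jV.
    apply: integral_sub; first exact: int_j.
    case: ifP => _; last exact: integral0.
    exact: (integral_mul (int_j u) int_c).
have [u [p [u0 e]]] := slice b.
have -> : tofrac b = (tofrac (j u))^-1 * (map_poly J p).[tofrac r].
  by rewrite evJ -e tofracM mulKf // j0.
apply: (integral_mul (int_jV u)); apply: integral_horner; last exact: int_r.
by apply/integral_poly => i; rewrite coef_map; apply: int_j.
Qed.

Lemma LND_minpoly D1 D2 a c :
    LND D1 -> LND D2 -> D1 a = 0 -> D2 c = 0 -> D2 a != 0 -> D1 c != 0 ->
  forall b, exists H : {poly {poly {poly k}}},
    [/\ H \is monic, evalX (evalX (evalX iota a) c) b H = 0 &
      forall G, evalX (evalX (evalX iota a) c) b G = 0 -> G != 0 -> (size H <= size G)%N].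
Proof.
move=> hD1 hD2 D1a D2c D2a D1c b.
have ak c' : a <> iota c'.
  by move=> e; case/eqP: D2a; rewrite e LND_const.
have ck c' : c <> iota c'.
  by move=> e; case/eqP: D1c; rewrite e LND_const.
have evE p : eval2 iotaK (tofrac a) (tofrac c) p = tofrac (evalX (evalX iota a) c p).
  rewrite /eval2 /= !evalXE -horner_map -map_poly_comp; congr (_.[_]).
  by apply: eq_map_poly => x /=; rewrite evalX_iotaK.
have indep p : eval2 iotaK (tofrac a) (tofrac c) p = 0 -> p = 0.
  rewrite evE => /eqP; rewrite tofrac_eq0 => /eqP.
  apply: (transcendental_over_kernel _ hD1 hcB _ D1c).
    move=> q q' e; apply/eqP; rewrite -subr_eq0; apply/eqP.
    by apply: (nonconst_transcendental ak); rewrite rmorphB /= e subrr.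
  by move=> q; apply: LND_evalX.
have evE3 H : evalX (eval2 iotaK (tofrac a) (tofrac c)) (tofrac b) H =
    tofrac (evalX (evalX (evalX iota a) c) b H).
  rewrite !evalXE -horner_map -map_poly_comp; congr (_.[_]).
  by apply: eq_map_poly => x /=; rewrite -evE.
have [H [Hmon Hb Hmin]] := bivariate_minpoly indep
  (LND_integral_over_line b hD1 D1a ak D1c) (LND_integral_over_line b hD2 D2c ck D2a).
exists H; split=> //.
  by move: Hb; rewrite evE3 => /eqP; rewrite tofrac_eq0 => /eqP.
by move=> G Gb; apply: Hmin; rewrite evE3 Gb tofrac0.
Qed.

Lemma LND_conductor D x : LND D -> (exists b, D b != 0) -> integralOver (@tofrac B) x ->
  exists a b, [/\ a != 0, D a = 0 & tofrac a * x = tofrac b].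
Proof.
move=> hD [b0 Db0] x_int; have [r [Dr DDr]] := exists_slice hD Db0.
have [A [j [j_inj jker]]] := derivation_kernel hD.1.
have Dj al : D (j al) = 0 by apply/jker; exists al.
have slice b' := slice_expansion hD hcB Dj b' (fun b => proj1 (jker b)) Dr DDr.
have [p|a [b [a0 e]]] := @kernel_conductor A B j r _ slice x x_int.
  exact: (transcendental_over_kernel j_inj hD hcB Dj Dr).
by exists (j a), b; rewrite Dj; split=> //; rewrite -(rmorph0 j) (inj_eq j_inj).
Qed.
End ClassM.

(** * The primes that contain a and c *)

Section GoingDown.
Variables (k : fieldType) (B : idomainType) (iota : {rmorphism k -> B}) (a c : B).
Notation S := {poly {poly k}}.
Let th : {rmorphism S -> B} := evalX (evalX iota a) c.
Hypothesis minpolyB : forall b, exists H : {poly S},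
  [/\ H \is monic, evalX th b H = 0 &
      forall G, evalX th b G = 0 -> G != 0 -> (size H <= size G)%N].

Lemma eval_mod_ac (h : S) : exists s t, th h = iota h.[0].[0] + (s * a + t * c).
Proof.
have /factor_theorem[q qE] : root (h - h.[0]%:P) 0 by rewrite /root !hornerE subrr.
have /factor_theorem[q' q'E] : root (h.[0] - h.[0].[0]%:P) 0 by rewrite /root !hornerE subrr.
exists (evalX iota a q'), (th q).
have e1 : th h - evalX iota a h.[0] = th q * c.
  by rewrite -(evalXC (evalX iota a) c) -rmorphB /= qE subr0 rmorphM /= /th /= evalX_X.
have e2 : evalX iota a h.[0] - iota h.[0].[0] = evalX iota a q' * a.
  by rewrite -(evalXC iota a) -rmorphB /= q'E subr0 rmorphM /= evalX_X.
by rewrite -e1 -e2; ring.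
Qed.

Lemma integral_mod_ac b : exists p : {poly k}, p \is monic /\
  exists s t, (map_poly iota p).[b] = s * a + t * c.
Proof.
have [H [Hmon Hb _]] := minpolyB b.
pose ep : {rmorphism S -> k} := horner_eval 0 \o horner_eval (0 : {poly k}).
exists (map_poly ep H); split; first exact: monic_map.
have [s sE] := choice eval_mod_ac; have [t tE] := choice sE.
exists (- \sum_(i < size H) s H`_i * b ^+ i), (- \sum_(i < size H) t H`_i * b ^+ i).
apply/eqP; rewrite -map_poly_comp horner_map_sum -subr_eq0 -[X in _ == X]Hb.
rewrite evalXE horner_map_sum !mulNr -opprD opprK !mulr_suml -!big_split /=.
apply/eqP; apply: eq_bigr => i _; rewrite tE /ep /= /horner_eval; ring.
Qed.

Lemma size_scaled (H : {poly S}) (f : nat -> S) : H \is monic -> f (size H).-1 != 0 ->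
  size (\poly_(i < size H) (H`_i * f i)) = size H.
Proof.
move=> Hmon f0; apply: size_poly_eq.
by rewrite -/(lead_coef H) (monicP Hmon) mul1r.
Qed.

Lemma evalX_poly (z : B) n (E : nat -> S) :
  evalX th z (\poly_(i < n) E i) = \sum_(i < n) th (E i) * z ^+ i.
Proof.
rewrite evalXE; have -> : map_poly th (\poly_(i < n) E i) = \poly_(i < n) th (E i).
  by apply/polyP => i; rewrite coef_map !coef_poly; case: ifP => // _; rewrite raddf0.
by rewrite horner_poly.
Qed.

(** Scaling the roots turns the minimal polynomials of [t] and [u] over [k(a, c)] into each
    other, up to a factor. As they have coefficients in the factorial ring [k[a, c]], the lower
    coefficients of that of [t] are divisible by [a], so that a power of [t] lies in [a B]. This is
    the classical proof of going down for the prime [(a)] of [k[a, c]]. *)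
Lemma going_down (P : prime_idealr B) t u n : a \in P -> t * c ^+ n = a * u -> t \in P.
Proof.
move=> aP tcau.
have [Ht [Htmon Htt Htmin]] := minpolyB t; have [Hu [Humon Huu Humin]] := minpolyB u.
pose X1 : S := 'X%:P.
have thX1 : th X1 = a by rewrite /th /= evalXC; apply: evalX_X.
have thX : th 'X = c by rewrite /th /= evalX_X.
have X1n0 m : X1 ^+ m != 0 by rewrite expf_neq0 // polyC_eq0 polyX_eq0.
have Xn0 m : ('X : S) ^+ m != 0 by rewrite expf_neq0 // polyX_eq0.
set dt := (size Ht).-1; set du := (size Hu).-1.
have dtE : size Ht = dt.+1 by rewrite prednK // size_poly_gt0 monic_neq0.
have duE : size Hu = du.+1 by rewrite prednK // size_poly_gt0 monic_neq0.
have Htt' : \sum_(i < size Ht) th Ht`_i * t ^+ i = 0 by rewrite -horner_map_sum.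
have Huu' : \sum_(i < size Hu) th Hu`_i * u ^+ i = 0 by rewrite -horner_map_sum.
pose f i : S := 'X ^+ (n * i) * X1 ^+ (du - i).
pose G : {poly S} := \poly_(i < size Hu) (Hu`_i * f i).
have szG : size G = size Hu by apply: size_scaled => //; rewrite mulf_neq0.
have Gt : evalX th t G = 0.
  rewrite evalX_poly -[RHS](mulr0 (a ^+ du)) -[in RHS]Huu' mulr_sumr; apply: eq_bigr => i _.
  have -> : a ^+ du = a ^+ (du - i) * a ^+ i.
    by rewrite -exprD subnK // -ltnS -duE.
  rewrite /f !rmorphM !rmorphXn /= thX thX1 exprM.
  have := congr1 (fun z => z ^+ i) tcau; rewrite !exprMn => e.
  set hu := th _; set A := a ^+ (du - i).
  have -> : hu * (c ^+ n ^+ i * A) * t ^+ i = hu * A * (t ^+ i * c ^+ n ^+ i) by ring.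
  by rewrite e; ring.
pose f' i : S := X1 ^+ i * 'X ^+ (n * (dt - i)).
pose G' : {poly S} := \poly_(i < size Ht) (Ht`_i * f' i).
have szG' : size G' = size Ht by apply: size_scaled => //; rewrite mulf_neq0.
have G'u : evalX th u G' = 0.
  rewrite evalX_poly -[RHS](mulr0 (c ^+ (n * dt))) -[in RHS]Htt' mulr_sumr; apply: eq_bigr => i _.
  have -> : c ^+ (n * dt) = c ^+ (n * (dt - i)) * c ^+ n ^+ i.
    by rewrite -exprM -exprD -mulnDr subnK // -ltnS -dtE.
  rewrite /f' !rmorphM !rmorphXn /= thX thX1.
  have := congr1 (fun z => z ^+ i) tcau; rewrite !exprMn => e.
  set ht := th _; set A := c ^+ (n * (dt - i)).
  have -> : ht * (a ^+ i * A) * u ^+ i = ht * A * (a ^+ i * u ^+ i) by ring.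
  by rewrite -e; ring.
have neq0 (Q : {poly S}) m : size Q = m.+1 -> Q != 0.
  by move=> e; rewrite -size_poly_gt0 e.
have dd : dt = du.
  apply: succn_inj; rewrite -dtE -duE; apply/eqP; rewrite eqn_leq; apply/andP; split.
    by rewrite -szG; apply: Htmin => //; apply: (neq0 _ du); rewrite szG.
  by rewrite -szG'; apply: Humin => //; apply: (neq0 _ dt); rewrite szG'.
(* the two annihilators of t coincide *)
have GE : G = ('X ^+ (n * du))%:P * Ht.
  apply/eqP; rewrite -subr_eq0; apply/negPn/negP => d0.
  have : (size Ht <= size (G - ('X ^+ (n * du))%:P * Ht)%R)%N.
    apply: Htmin d0; rewrite rmorphB rmorphM /= Gt [evalX th t Ht]Htt mulr0 subr0 //.
  rewrite leqNgt dtE ltnS dd => /negP; apply.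
  apply/leq_sizeP => l; rewrite leq_eqVlt => /predU1P[<-|lt].
    rewrite coefB coefCM coef_poly duE ltnSn -/(lead_coef Hu) (monicP Humon) mul1r.
    have -> : Ht`_du = 1 by rewrite -dd; apply/monicP.
    by rewrite /f subnn expr0 !mulr1 subrr.
  rewrite nth_default // (leq_trans _ lt) // (leq_trans (size_polyD _ _)) // geq_max.
  rewrite size_polyN szG duE leqnn mul_polyC (leq_trans (size_scale_leq _ _)) //.
  by rewrite dtE dd.
have Hti i : (i < dt)%N -> exists w, Ht`_i = w * X1.
  move=> idt; have := congr1 (fun Q : {poly S} => Q`_i) GE.
  rewrite coefCM coef_poly duE -dd ltnS ltnW // /f -dd => e.
  apply: (@mem_bipoly k _ (Hu`_i * ('X ^+ (n * i) * X1 ^+ (dt - i.+1))) 'X ('X ^+ (n * dt))).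
  - by rewrite polyX_eq0.
  - by rewrite expf_neq0 // polyX_eq0.
  - have eX : X1 ^+ (dt - i) = X1 ^+ (dt - i.+1) * X1 by rewrite -exprSr subnSK.
    by rewrite rmorphXn /= map_polyX mulrC -e eX !mulrA.
have tdP : t ^+ dt \in P.
  move: Htt'; rewrite dtE big_ord_recr /= -/(lead_coef Ht) (monicP Htmon) rmorph1 mul1r.
  move=> /eqP; rewrite addrC addr_eq0 => /eqP ->; rewrite rpredN; apply: rpred_sum => i _.
  have [w ->] := Hti i (ltn_ord i); rewrite rmorphM /= thX1.
  by rewrite mulrAC idealMr.
elim: (dt) tdP => [|m IH]; first by rewrite expr0 idealr1.
by rewrite exprS prime_idealrM => /orP[].
Qed.
End GoingDown.

(** * Normality *)

Section Localization.
Variables (B : idomainType) (P : prime_idealr B).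

Lemma loc_valM (y z : localization P) : loc_val (y * z) = loc_val y * loc_val z.
Proof. exact: (rmorphM (\val : localization P -> {fraction B})). Qed.

Lemma loc_val0 : loc_val (0 : localization P) = 0.
Proof. exact: (rmorph0 (\val : localization P -> {fraction B})). Qed.

Lemma loc_val1 : loc_val (1 : localization P) = 1.
Proof. exact: (rmorph1 (\val : localization P -> {fraction B})). Qed.

Lemma loc_valX (y : localization P) n : loc_val (y ^+ n) = loc_val y ^+ n.
Proof. exact: (rmorphXn (\val : localization P -> {fraction B})). Qed.

Lemma localizationP (x : {fraction B}) :
  (exists y : localization P, x = loc_val y) <->
  (exists b s, s \notin P /\ x = tofrac b / tofrac s).
Proof.
split=> [[y ->]|h]; first by have /asboolP := valP y.
have xP : x \in loc_pred P by apply/asboolP.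
by exists (Localization xP).
Qed.

(** Since [s2 ^ e2 * (s1 ^ e1 * x)] is a multiple of [s1] in the local ring when [e1 > 0], so is
    [s1 ^ e1 * x], because [s2] is regular modulo [s1]: this lowers the exponent [e1] by one. *)
Lemma regular_pair_denominators (s1 s2 : localization P) s (x : {fraction B}) e1 e2
    (v1 v2 : localization P) :
    regular_seq [:: s1, s2 & s] ->
    loc_val s1 ^+ e1 * x = loc_val v1 -> loc_val s2 ^+ e2 * x = loc_val v2 ->
  exists v : localization P, x = loc_val v.
Proof.
case=> reg _.
have s1_neq0 : loc_val s1 != 0.
  apply/negP => /eqP s10; have [|c /eqP] := reg 0%N 1 isT.
    exists (fun=> 0); rewrite big_ord0; apply: val_inj.
    change (loc_val (s1 * 1) = loc_val (0 : localization P)).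
    by rewrite loc_valM s10 mul0r loc_val0.
  by rewrite big_ord0 oner_eq0.
have reg2 y z : s2 * y = s1 * z -> exists w, y = s1 * w.
  move=> e; have [|c ->] := reg 1%N y isT.
    by exists (fun=> z); rewrite big_ord1 /= e mulrC.
  by exists (c 0%N); rewrite big_ord1 mulrC.
have reg2X e y z : s2 ^+ e * y = s1 * z -> exists w, y = s1 * w.
  elim: e z => [|e IH] z; first by rewrite expr0 mul1r; exists z.
  by rewrite exprS -mulrA => /reg2[w /IH].
move=> h1 h2; elim: e1 v1 h1 => [|e IH] v; first by rewrite expr0 mul1r; exists v.
move=> h1; have [|w vE] := reg2X e2 v (s1 ^+ e * v2).
  apply: val_inj; change (loc_val (s2 ^+ e2 * v) = loc_val (s1 * (s1 ^+ e * v2))).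
  rewrite !loc_valM !loc_valX -h1 -h2 exprS.
  by rewrite -!mulrA mulrCA; congr (_ * _); rewrite mulrCA.
apply: (IH w); apply: (mulfI s1_neq0).
by rewrite mulrA -exprS h1 vE loc_valM.
Qed.
End Localization.

Section SerreS2.
Variables (k : fieldType) (B : idomainType) (iota : {rmorphism k -> B}) (a c : B).
Hypothesis minpolyB : forall b, exists H : {poly {poly {poly k}}},
  [/\ H \is monic, evalX (evalX (evalX iota a) c) b H = 0 &
      forall G, evalX (evalX (evalX iota a) c) b G = 0 -> G != 0 -> (size H <= size G)%N].
Hypothesis dimB : is_krull_dim B 2.

(** The preceding going-down property provides a prime between [0] and [P] that contains [a]
    but not [c]. *)
Lemma prime_height2 (P : prime_idealr B) : a != 0 -> a \in P -> c \in P -> is_height P 2.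
Proof.
move=> a0 aP cP.
have [Z ZE] := zero_prime B.
have [|||||Q [aQ MQ]] := @prime_avoid B (fun x => exists u, x = a * u)
    (fun x => exists t n, t \notin P /\ x = t * c ^+ n).
- by exists 0; rewrite mulr0.
- by move=> r _ _ [u ->] [v ->]; exists (r * u + v); ring.
- by exists 1, 0%N; rewrite idealr1 mulr1.
- move=> _ _ [t [n [tP ->]]] [t' [n' [t'P ->]]]; exists (t * t'), (n + n')%N.
  by rewrite prime_idealrM negb_or tP t'P exprD; split=> //; ring.
- move=> x [u xE] [t [n [tP xE']]]; case/negP: tP.
  by apply: (going_down minpolyB aP (u := u) (n := n)); rewrite -xE'.
have cQ : c \notin Q by apply: MQ; exists 1, 1%N; rewrite idealr1 mul1r.
split; last by move=> m [C Cc _]; apply: dimB.2; exists C.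
exists (fun i => if i is 0%N then Z else if i is 1%N then Q else P) => //.
move=> [|[|//]] _; split.
- by move=> x /ZE ->; apply: idealr0.
- exists a; first by apply: aQ; exists 1; rewrite mulr1.
  by apply/negP => /ZE /eqP; rewrite (negbTE a0).
- move=> x; apply: contraLR => xP; apply: MQ; exists x, 0%N; by rewrite mulr1.
- by exists c.
Qed.

(** Modulo [(a, c)] the ring is algebraic over [k], so that in the local ring at a prime over
    [(a, c)] every non-unit has a power in the ideal generated by [a] and [c]. *)
Lemma nonunit_power_denominator (P : prime_idealr B) (x : {fraction B}) (a1 c1 : B) y :
    tofrac a * x = tofrac a1 -> tofrac c * x = tofrac c1 ->
    (forall b b', tofrac b * x = tofrac b' -> b \in P) ->
    (~ exists z : localization P, y * z = 1) ->
  exists e (v : localization P), loc_val y ^+ e * x = loc_val v.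
Proof.
move=> ax cx IP ynu.
have [b [s [sP yE]]] := (localizationP P (loc_val y)).1 (ex_intro _ y erefl).
have s0 : tofrac s != 0 by apply: notin_prime_neq0 sP.
have bP : b \in P.
  apply/negPn/negP => bP; apply: ynu.
  have [z zE] := (localizationP P (tofrac s / tofrac b)).2
    (ex_intro _ s (ex_intro _ b (conj bP erefl))).
  exists z; apply: val_inj; change (loc_val (y * z) = loc_val (1 : localization P)).
  rewrite loc_valM loc_val1 yE -zE.
  by rewrite mulf_div [X in X / _]mulrC divff // mulf_neq0 // (notin_prime_neq0 bP).
have [p [pmon [u [v pb]]]] := integral_mod_ac minpolyB b.
have [m [q]] := multiplicity_XsubC p 0.
rewrite monic_neq0 //= subr0 => q0 pE.
have qbP : (map_poly iota q).[b] \notin P.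
  have /factor_theorem[r rE] : root (q - q.[0]%:P) 0 by rewrite /root !hornerE subrr.
  have -> : (map_poly iota q).[b] = (map_poly iota r).[b] * b + iota q.[0].
    rewrite -[q in LHS](subrK q.[0]%:P) rE subr0 rmorphD rmorphM /= map_polyX map_polyC.
    by rewrite !hornerE.
  apply/negP => h; have : iota q.[0] \in P.
    by rewrite -[iota _](addKr ((map_poly iota r).[b] * b)) rpredD // rpredN idealMr.
  move=> /(idealMr (iota q.[0]^-1)); rewrite -rmorphM mulVf ?rmorph1 ?idealr1 //.
have qb0 : tofrac (map_poly iota q).[b] != 0 by apply: notin_prime_neq0 qbP.
have num : tofrac (u * a1 + v * c1) = tofrac b ^+ m * tofrac (map_poly iota q).[b] * x.
  have -> : tofrac (u * a1 + v * c1) = tofrac (u * a + v * c) * x.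
    by rewrite !tofracD !tofracM mulrDl -!mulrA ax cx.
  rewrite -pb pE rmorphM rmorphXn /= map_polyX hornerM horner_exp hornerX.
  by rewrite tofracM tofracXn; congr (_ * _); rewrite mulrC.
exists m; apply/(localizationP P).
exists (u * a1 + v * c1), ((map_poly iota q).[b] * s ^+ m); split.
  rewrite prime_idealrM negb_or qbP /=.
  elim: (m) => [|m' IH]; first by rewrite expr0 idealr1.
  by rewrite exprS prime_idealrM negb_or sP.
have sm0 : tofrac s ^+ m != 0 by rewrite expf_neq0.
rewrite num yE tofracM tofracXn expr_div_n.
move: (tofrac b ^+ m) (tofrac (map_poly iota q).[b]) (tofrac s ^+ m) qb0 sm0.
move=> bm Q sm Q0 sm0; apply: (mulIf (mulf_neq0 Q0 sm0)).
rewrite divfK ?mulf_neq0 // [Q * sm]mulrC mulrA [bm / sm * x * sm]mulrAC divfK //.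
by rewrite mulrAC.
Qed.

(** The denominators [b] with [b x] in [B] form an ideal containing [a] and [c]; if it were
    proper, condition (S2) at a prime above it would make [x] an element of the local ring. *)
Lemma serre_S2_descent (x : {fraction B}) a1 c1 : serre_S2 B -> a != 0 ->
  tofrac a * x = tofrac a1 -> tofrac c * x = tofrac c1 -> exists b, x = tofrac b.
Proof.
move=> S2 a0 ax cx; apply: contrapT => xB.
pose I b := exists b', tofrac b * x = tofrac b'.
have [|||||P [IP _]] := @prime_avoid B I (fun b => b = 1).
- by exists 0; rewrite tofrac0 mul0r.
- move=> r u v [u' uE] [v' vE]; exists (r * u' + v').
  by rewrite !tofracD !tofracM mulrDl -mulrA uE vE.
- by [].
- by move=> u v -> ->; rewrite mulr1.
- by move=> b [b' e] b1; apply: xB; exists b'; rewrite -e b1 tofrac1 mul1r.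
have aP : a \in P by apply: IP; exists a1.
have cP : c \in P by apply: IP; exists c1.
have IP' b b' : tofrac b * x = tofrac b' -> b \in P by move=> e; apply: IP; exists b'.
have [[|s1 [|s2 s]] [sz reg nu]] := S2 P 2 (prime_height2 a0 aP cP) => //.
have [|e1 [v1 h1]] := nonunit_power_denominator (y := s1) ax cx IP'.
  by apply: nu; rewrite inE eqxx.
have [|e2 [v2 h2]] := nonunit_power_denominator (y := s2) ax cx IP'.
  by apply: nu; rewrite !inE eqxx orbT.
have /(localizationP P)[b [t [tP xE]]] := regular_pair_denominators reg h1 h2.
have t0 := notin_prime_neq0 tP; case/negP: tP; apply: (IP' t b).
by rewrite xE mulrC divfK.
Qed.
End SerreS2.

Theorem corollary5p3 (k : fieldType) (hk : [pchar k]%R =i pred0)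
    (B : idomainType) (iota : {rmorphism k -> B}) (hB : classM iota) :
  (serre_S2 B -> normal_domain B) /\
  (complete_intersection iota -> normal_domain B).
Proof.
have hk0 := pchar0_char0 hk; have [_ dimB _] := hB.
have [D1 [D2 [hD1 hD2 D1n D2n D12]]] := two_LNDs hk0 hB.
(* each half only has to show that x lies in B once a * x and c * x do *)
suff reduce (x : {fraction B}) : integralOver (@tofrac B) x ->
    (forall a c a1 c1, a != 0 ->
       (forall b, exists H : {poly {poly {poly k}}},
         [/\ H \is monic, evalX (evalX (evalX iota a) c) b H = 0 &
           forall G, evalX (evalX (evalX iota a) c) b G = 0 -> G != 0 ->
             (size H <= size G)%N]) ->
       tofrac a * x = tofrac a1 -> tofrac c * x = tofrac c1 ->
       exists b, x = tofrac b) ->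
    exists b, x = tofrac b.
  split=> [S2|ci] x /reduce; apply=> a c a1 c1 a0 minB ax cx.
    exact: (serre_S2_descent minB dimB S2 a0 ax cx).
  have cu : c * a1 = a * c1.
    by apply/eqP; rewrite -tofrac_eq !tofracM -ax -cx mulrCA.
  have [v vE] := complete_intersection_regular ci dimB (integral_mod_ac minB) cu.
  exists v; apply: (mulfI (x := tofrac a)); first by rewrite tofrac_eq0.
  by rewrite ax vE tofracM mulrC.
move=> x_int W.
have [a [a1 [a0 D1a ax]]] := LND_conductor iota hk0 hD1 D1n x_int.
have [c [c1 [c0 D2c cx]]] := LND_conductor iota hk0 hD2 D2n x_int.
have const z z1 l : z != 0 -> tofrac z * x = tofrac z1 -> z = iota l ->
    exists b, x = tofrac b.
  move=> z0 zx zE; have l0 : l != 0 by apply: contraNneq z0 => l0; rewrite zE l0 rmorph0.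
  exists (iota l^-1 * z1).
  by rewrite tofracM -zx mulrA -tofracM zE -rmorphM mulVf // rmorph1 tofrac1 mul1r.
have [D2a|D2a] := eqVneq (D2 a) 0.
  by have [l /(const _ _ _ a0 ax)] := D12 a D1a D2a.
have [D1c|D1c] := eqVneq (D1 c) 0.
  by have [l /(const _ _ _ c0 cx)] := D12 c D1c D2c.
by apply: (W a c a1 c1) => //; apply: (LND_minpoly hk0 hB hD1 hD2 D1a D2c D2a D1c).
Qed.
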